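(* Let $G_\omega$ be a weighted tree on four distinct vertices $a,b,x,y$ with edge set $E(G)=\{ab,ax,by\}$ and weight function $\omega:E(G)\to\mathbb{Z}_{>0}$. Then $I(G_\omega)^n$ is Cohen-Macaulay for all $n\ge 1$ if and only if $\min\{\omega(ax),\omega(by)\}\ge 2\omega(ab)$.
   Context: Let $K$ be a field and $R=K[a,b,x,y]$. The weighted edge ideal is $I(G_\omega)=\big((uv)^{\omega(uv)} : uv\in E(G)\big)\subset R$. An ideal $I\subset R$ is called Cohen-Macaulay if $R/I$ is a Cohen-Macaulay ring. *)

(* Defs.v *)
From HB Require Import structures.
From mathcomp Require Import all_boot all_algebra.
From mathcomp Require Import generic_quotient ring_quotient.
From mathcomp Require Import mpoly.
From mathcomp Require Import boolp.
From mathcomp Require Import ring.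

Set Implicit Arguments.
Unset Strict Implicit.
Unset Printing Implicit Defensive.

Import GRing.Theory.
Local Open Scope ring_scope.
Local Open Scope quotient_scope.

(* Ideals are subsets [{pred A}].  In [ring_quotient], [idealr_closed],
   [idealr] and [prime_idealr] all require the ideal to be proper. *)
Section Ideals.
Variable A : comNzRingType.
Implicit Types (S I J M : {pred A}) (s : seq A).

Definition ideal_gen S : {pred A} := [pred z | `[< exists c : seq (A * A),
  {in c, forall u, u.2 \in S} /\ z = \sum_(u <- c) u.1 * u.2 >]].

Definition ideal_mul I J : {pred A} := ideal_gen [pred z |
  `[< exists f g, [/\ f \in I, g \in J & z = f * g] >]].

Definition ideal_exp I (n : nat) : {pred A} := iter n (ideal_mul I) predT.

Definition noetherian : Prop :=
  forall I, idealr_closed I -> exists s, I =i ideal_gen (mem s).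

Definition maximal_ideal M : Prop := idealr_closed M /\
  forall J, idealr_closed J -> {subset M <= J} -> {subset J <= M}.

Definition local_with M : Prop :=
  maximal_ideal M /\ forall J, maximal_ideal J -> J =i M.

Definition regular_sequence s : Prop :=
  (forall i z, (i < size s)%N -> z * s`_i \in ideal_gen (mem (take i s)) ->
    z \in ideal_gen (mem (take i s)))
  /\ 1 \notin ideal_gen (mem s).

(* Strictly increasing chains p 0 < ... < p d; the values p i with d < i are
   irrelevant. *)
Definition prime_chain (d : nat) : Prop := exists p : nat -> prime_idealr A,
  forall i, (i < d)%N ->
    {subset (p i : {pred A}) <= (p i.+1 : {pred A})} /\
    ~ {subset (p i.+1 : {pred A}) <= (p i : {pred A})}.

Definition is_max (P : nat -> Prop) (d : nat) : Prop :=
  P d /\ forall e, P e -> (e <= d)%N.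

Definition krull_dim_is (d : nat) : Prop := is_max prime_chain d.

Definition depth_is M (d : nat) : Prop :=
  is_max (fun e => exists s,
    [/\ size s = e, {subset s <= M} & regular_sequence s]) d.

End Ideals.

(* The localization A_P: fractions n/d with d \notin P, where n/d = n'/d' iff
   t (n d' - n' d) = 0 for some t \notin P. *)
Module Localization.
Section Localization.
Variables (A : comNzRingType) (P : prime_idealr A).
Local Notation I := (P : {pred A}).

Record ratio := Ratio { frac :> A * A; den_ratio : frac.2 \notin I }.
#[export]
HB.instance Definition _ := [isSub for frac].
#[export]
HB.instance Definition _ := [Choice of ratio by <:].
Implicit Types u v w : ratio.

Local Notation num u := (frac u).1.
Local Notation den u := (frac u).2.

Lemma notin1 : 1 \notin I. Proof. by rewrite idealr1. Qed.

Lemma notinM a b : a \notin I -> b \notin I -> a * b \notin I.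
Proof. by move=> aI bI; rewrite prime_idealrM negb_or aI. Qed.

Definition equiv u v : bool :=
  `[< exists2 t, t \notin I & t * (num u * den v - num v * den u) = 0 >].

Lemma equiv_refl : reflexive equiv.
Proof. by move=> u; apply/asboolP; exists 1; rewrite ?notin1 // subrr mulr0. Qed.

Lemma equiv_sym : ssrbool.symmetric equiv.
Proof.
move=> u v; apply/asboolP/asboolP => -[t tI e]; exists t => //.
  by rewrite -opprB mulrN e oppr0.
by rewrite -opprB mulrN e oppr0.
Qed.

Lemma equiv_trans : transitive equiv.
Proof.
move=> v u w /asboolP[s sI es] /asboolP[t tI et]; apply/asboolP.
exists (s * t * den v); first by rewrite !notinM // den_ratio.
have -> : s * t * den v * (num u * den w - num w * den u) =
  t * den w * (s * (num u * den v - num v * den u)) +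
  s * den u * (t * (num v * den w - num w * den v)).
  by ring.
by rewrite es et !mulr0 addr0.
Qed.

Canonical equiv_equiv := EquivRel equiv equiv_refl equiv_sym equiv_trans.

Definition type := {eq_quot equiv}.
#[export]
HB.instance Definition _ : EqQuotient _ equiv type := EqQuotient.on type.
#[export]
HB.instance Definition _ := Choice.on type.


Definition ratio0 : ratio := @Ratio (0, 1) notin1.
Definition ratio1 : ratio := @Ratio (1, 1) notin1.
Definition oppr u : ratio := @Ratio (- num u, den u) (den_ratio u).
Definition addr u v : ratio :=
  @Ratio (num u * den v + num v * den u, den u * den v)
         (notinM (den_ratio u) (den_ratio v)).
Definition mulr u v : ratio :=
  @Ratio (num u * num v, den u * den v) (notinM (den_ratio u) (den_ratio v)).

Lemma equivP u v :
  reflect (exists2 t, t \notin I & t * (num u * den v - num v * den u) = 0)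
          (u == v %[mod type]).
Proof. by rewrite eqmodE; apply: asboolP. Qed.

Lemma equiv_cross u v : num u * den v = num v * den u -> u = v %[mod type].
Proof.
by move=> e; apply/eqP/equivP; exists 1; rewrite ?notin1 // e subrr mulr0.
Qed.

Lemma repr_pi u :
  exists2 t, t \notin I
    & t * (num (repr (\pi_type u)) * den u - num u * den (repr (\pi_type u))) = 0.
Proof. by apply/equivP; rewrite reprK. Qed.

Definition zero : type := \pi_type ratio0.
Definition one : type := \pi_type ratio1.
Definition opp := lift_op1 type oppr.
Definition add := lift_op2 type addr.
Definition mul := lift_op2 type mulr.

Lemma pi_opp : {morph \pi_type : u / oppr u >-> opp u}.
Proof.
move=> u; unlock opp; apply/eqP/equivP => /=.
have [t tI e] := repr_pi u; exists t => //=.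
set v := repr _ in e *.
by transitivity (t * (num v * den u - num u * den v)); [ring | exact: e].
Qed.

Lemma pi_add : {morph \pi_type : u v / addr u v >-> add u v}.
Proof.
move=> u v; unlock add; apply/eqP/equivP => /=.
have [s sI es] := repr_pi u; have [t tI et] := repr_pi v.
set u' := repr (_ u) in es *; set v' := repr (_ v) in et *.
exists (s * t); first exact: notinM.
transitivity (- (s * (num u' * den u - num u * den u')) * (t * den v * den v')
  - (t * (num v' * den v - num v * den v')) * (s * den u * den u')); first by ring.
by rewrite es et oppr0 !mul0r subr0.
Qed.

Lemma pi_mul : {morph \pi_type : u v / mulr u v >-> mul u v}.
Proof.
move=> u v; unlock mul; apply/eqP/equivP => /=.
have [s sI es] := repr_pi u; have [t tI et] := repr_pi v.
set u' := repr (_ u) in es *; set v' := repr (_ v) in et *.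
exists (s * t); first exact: notinM.
transitivity (- (s * (num u' * den u - num u * den u')) * (t * num v' * den v)
  - (t * (num v' * den v - num v * den v')) * (s * num u * den u')); first by ring.
by rewrite es et oppr0 !mul0r subr0.
Qed.

Lemma addA : associative add.
Proof.
elim/quotW=> u; elim/quotW=> v; elim/quotW=> w; rewrite -!pi_add.
by apply: equiv_cross => /=; ring.
Qed.

Lemma addC : commutative add.
Proof.
elim/quotW=> u; elim/quotW=> v; rewrite -!pi_add.
by apply: equiv_cross => /=; ring.
Qed.

Lemma add0 : left_id zero add.
Proof.
by elim/quotW=> u; rewrite -!pi_add; apply: equiv_cross => /=; ring.
Qed.

Lemma addN : left_inverse zero opp add.
Proof.
elim/quotW=> u; rewrite -pi_opp -!pi_add.
by apply: equiv_cross => /=; ring.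
Qed.

#[export]
HB.instance Definition _ := GRing.isZmodule.Build type addA addC add0 addN.

Lemma mulA : associative mul.
Proof.
elim/quotW=> u; elim/quotW=> v; elim/quotW=> w; rewrite -!pi_mul.
by apply: equiv_cross => /=; ring.
Qed.

Lemma mulC : commutative mul.
Proof.
elim/quotW=> u; elim/quotW=> v; rewrite -!pi_mul.
by apply: equiv_cross => /=; ring.
Qed.

Lemma mul1 : left_id one mul.
Proof.
by elim/quotW=> u; rewrite -!pi_mul; apply: equiv_cross => /=; ring.
Qed.

Lemma mulDl : left_distributive mul add.
Proof.
elim/quotW=> u; elim/quotW=> v; elim/quotW=> w.
rewrite -!pi_add -!pi_mul -!pi_add.
by apply: equiv_cross => /=; ring.
Qed.

Lemma one_neq0 : one != zero.
Proof.
apply/negP => /equivP[t tI /=]; rewrite !mulr1 subr0 mulr1 => t0.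
by rewrite t0 idealr0 in tI.
Qed.

#[export]
HB.instance Definition _ :=
  GRing.Zmodule_isComNzRing.Build type mulA mulC mul1 mulDl one_neq0.

End Localization.
Module Exports. HB.reexport. End Exports.
End Localization.
Export Localization.Exports.

Definition localization (A : comNzRingType) (P : prime_idealr A) :
  comNzRingType := Localization.type P.

Definition cohen_macaulay_local (B : comNzRingType) : Prop :=
  exists M : {pred B}, local_with M /\
    exists d : nat, depth_is M d /\ krull_dim_is B d.

(* Maximal ideals are prime, so P ranges over all maximal ideals of A. *)
Definition cohen_macaulay_ring (A : comNzRingType) : Prop :=
  noetherian A /\
  forall P : prime_idealr A, maximal_ideal P ->
    cohen_macaulay_local (localization P).

(* [J] is [I] together with a proof that it is a proper ideal, which is what
   the quotient ring construction takes. *)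
Definition cohen_macaulay_ideal (A : comNzRingType) (I : {pred A}) : Prop :=
  exists J : idealr A, (J : {pred A}) =i I /\
    cohen_macaulay_ring {ideal_quot J}.

(* Only the values of [weight] on [edges] are meaningful. *)
Record weighted_graph (n : nat) := WeightedGraph {
  edges : {set {set 'I_n}};
  edge_card : forall e, e \in edges -> #|e| = 2%N;
  weight : {set 'I_n} -> nat;
  weight_gt0 : forall e, e \in edges -> (0 < weight e)%N
}.

Definition weighted_edge_ideal (K : fieldType) (n : nat) (G : weighted_graph n)
    : {pred {mpoly K[n]}} :=
  ideal_gen [pred f | [exists e in edges G,
    f == (\prod_(v in e) 'X_v) ^+ weight G e]].
Arguments weighted_edge_ideal K {n} G.

(* Main.v *)
(* Let p, q, r be the weights of ab, ax, by. Membership of a monomial in I^k is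
   an explicit numerical condition (path_pow), so every ideal identity reduces
   to arithmetic on exponents.

   If q, r >= 2p, then I^(k+1) : (ab)^p = I^k, while I^(k+1) + (ab)^p is
   generated by (ab)^p, (ax)^(q(k+1)), (by)^(r(k+1)) and decomposes further by
   colons into the primes (a,b), (a,y), (x,b). Modulo each of these,
   theta1 = a + x and theta2 = b + y are the two remaining variables; hence
   G1(theta1), G2(theta2) is a weakly regular sequence modulo I^k for all nonzero
   polynomials G1, G2 over K. By Zariski's lemma every maximal ideal containing
   I^k contains such a pair, so every localization has depth at least 2. Its
   dimension is at most 2 because any three elements of K[s,t] are
   algebraically dependent, and depth never exceeds dimension.

   Otherwise, let F be a set of variables, m the ideal of the origin, and w a
   monomial such that w v v' lies in I^k for every v outside F and v' in F. The
   map f |-> w f|_F on m is then linear modulo I^k. If w v0 and w v0' are not in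
   I^k for some v0 outside F and v0' in F, the map is not a multiplication, so
   the depth at the origin is less than 2, although the dimension there is at
   least 2. Such data exist for k = 1 when q < p and for k = 2 when
   p <= q < 2p, up to the symmetry exchanging a, x with b, y. *)
Require Import Defs.
From HB Require Import structures.
From mathcomp Require Import all_boot all_order all_algebra.
From mathcomp Require Import generic_quotient ring_quotient polyXY mxpoly.
From mathcomp Require Import mpoly.
From mathcomp Require Import boolp classical_sets.
From mathcomp Require Import zify ring.

Set Implicit Arguments.
Unset Strict Implicit.
Unset Printing Implicit Defensive.

Import Order.TTheory GRing.Theory.
Local Open Scope ring_scope.

(** * Ideals, primes and regular sequences *)

(** Unlike [idealr_closed], this allows the unit ideal, since colon ideals and the sets used in
    generation arguments may be improper. *)
Definition is_ideal (A : comNzRingType) (I : A -> Prop) : Prop :=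
  I 0 /\ forall c u v, I u -> I v -> I (c * u + v).

Definition is_prime (A : comNzRingType) (P : A -> Prop) : Prop :=
  [/\ is_ideal P, ~ P 1 & forall u v, P (u * v) -> P u \/ P v].

Section Ideals.
Variable A : comNzRingType.
Implicit Types I J P : A -> Prop.

Lemma ideal0 I : is_ideal I -> I 0. Proof. by case. Qed.

Lemma idealD I u v : is_ideal I -> I u -> I v -> I (u + v).
Proof. by case=> _ h Iu Iv; rewrite -[u]mul1r; apply: h. Qed.

Lemma idealM I c u : is_ideal I -> I u -> I (c * u).
Proof. by case=> I0 h Iu; rewrite -[_ * _]addr0; apply: h. Qed.

Lemma idealMl I c u : is_ideal I -> I u -> I (u * c).
Proof. by rewrite mulrC; apply: idealM. Qed.

Lemma idealN I u : is_ideal I -> I u -> I (- u).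
Proof. by move=> hI Iu; rewrite -mulN1r; apply: idealM. Qed.

Lemma idealB I u v : is_ideal I -> I u -> I v -> I (u - v).
Proof. by move=> hI Iu Iv; apply: idealD => //; apply: idealN. Qed.

Lemma ideal_sum I (T : eqType) (r : seq T) (F : T -> A) : is_ideal I ->
  (forall i, i \in r -> I (F i)) -> I (\sum_(i <- r) F i).
Proof.
move=> hI h; rewrite big_seq; elim/big_ind: _ => //; first exact: ideal0.
by move=> u v; apply: idealD.
Qed.

Lemma prime_ideal P : is_prime P -> is_ideal P. Proof. by case. Qed.

Lemma primeM P u v : is_prime P -> ~ P u -> ~ P v -> ~ P (u * v).
Proof. by case=> _ _ h Pu Pv /h[]. Qed.

Lemma primeX P u n : is_prime P -> P (u ^+ n) -> P u.
Proof.
move=> hP; elim: n => [|n IH]; first by case: hP => _ h _ /h.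
by rewrite exprS; case: hP => _ _ h /h[].
Qed.

Lemma idealr_closed_is_ideal (I : {pred A}) :
  idealr_closed I -> is_ideal (fun z => z \in I).
Proof. by case=> I0 _ h; split=> // c u v Iu Iv; apply: h. Qed.

Lemma is_ideal_closed I : is_ideal I -> ~ I 1 ->
  idealr_closed ([pred z | `[< I z >]] : {pred A}).
Proof.
move=> hI I1; split; rewrite ?inE.
- exact: ideal0 hI.
- exact/asboolPn.
- by move=> c u v; rewrite !inE => ? ?; apply hI.
Qed.

Lemma proper_ideal_idealr I : is_ideal I -> ~ I 1 ->
  exists J : idealr A, forall z, z \in (J : {pred A}) <-> I z.
Proof.
move=> hI I1.
pose S : A -> bool := fun z => `[< I z >].
pose M := isIdealr.Build A S (is_ideal_closed hI I1).
pose J : idealr A := HB.pack S M.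
by exists J => z; exact: iff_sym (rwP (asboolP _)).
Qed.

Lemma is_prime_idealr P : is_prime P ->
  exists Q : prime_idealr A, forall z, z \in (Q : {pred A}) <-> P z.
Proof.
move=> [hI P1 hP].
pose S : A -> bool := fun z => `[< P z >].
have hS : prime_idealr_closed (S : {pred A}).
  by move=> u v /asboolP/hP[]/asboolT h; apply/orP; [left|right].
pose M := isIdealr.Build A S (is_ideal_closed hI P1).
pose N := isPrimeIdealrClosed.Build A S hS.
pose J : prime_idealr A := HB.pack S M N.
by exists J => z; exact: iff_sym (rwP (asboolP _)).
Qed.

Lemma idealr_is_ideal (J : idealr A) : is_ideal (fun z => z \in (J : {pred A})).
Proof.
split; first exact: idealr0.
by move=> c u v Ju Jv; apply: rpredD => //; apply: idealMr.
Qed.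

Lemma prime_idealr_is_prime (Q : prime_idealr A) :
  is_prime (fun z => z \in (Q : {pred A})).
Proof.
split; [exact: idealr_is_ideal | by rewrite idealr1 |].
by move=> u v; rewrite prime_idealrM => /orP.
Qed.

Lemma ideal_genP (S : {pred A}) z : z \in ideal_gen S <->
  exists c : seq (A * A), {in c, forall u, u.2 \in S} /\ z = \sum_(u <- c) u.1 * u.2.
Proof. exact: iff_sym (rwP (asboolP _)). Qed.

Lemma ideal_gen_is_ideal (S : {pred A}) : is_ideal (fun z => z \in ideal_gen S).
Proof.
split; first by apply/ideal_genP; exists [::]; rewrite big_nil.
move=> c _ _ /ideal_genP[s [hs ->]] /ideal_genP[t [ht ->]]; apply/ideal_genP.
exists ([seq (c * u.1, u.2) | u <- s] ++ t); split.
  by move=> u; rewrite mem_cat => /orP[/mapP[v /hs h ->] //|/ht].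
rewrite big_cat big_map mulr_sumr /=; congr (_ + _).
by apply: eq_bigr => u _; rewrite mulrA.
Qed.

Lemma sub_ideal_gen (S : {pred A}) z : z \in S -> z \in ideal_gen S.
Proof.
move=> Sz; apply/ideal_genP; exists [:: (1, z)]; rewrite big_seq1 mul1r.
by split=> // u; rewrite inE => /eqP ->.
Qed.

Lemma ideal_gen_min (S : {pred A}) I : is_ideal I ->
  (forall z, z \in S -> I z) -> forall z, z \in ideal_gen S -> I z.
Proof.
move=> hI h z /ideal_genP[c [hc ->]]; apply: ideal_sum => // u /hc/h.
exact: idealM.
Qed.

Lemma ideal_gen_nil z : z \in ideal_gen (mem [::] : {pred A}) <-> z = 0.
Proof.
split; last by move->; apply: (ideal_gen_is_ideal _).1.
apply: (@ideal_gen_min _ (fun z => z = 0)) => //.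
by split=> // c u v -> ->; rewrite mulr0 addr0.
Qed.

Lemma ideal_gen_seq1 f z :
  z \in ideal_gen (mem [:: f] : {pred A}) <-> exists c, z = c * f.
Proof.
split.
  apply: (@ideal_gen_min _ (fun z => exists c, z = c * f)).
    split; first by exists 0; rewrite mul0r.
    by move=> c _ _ [d ->] [e ->]; exists (c * d + e); rewrite mulrDl mulrA.
  by move=> u; rewrite inE => /eqP ->; exists 1; rewrite mul1r.
case=> c ->; apply: (idealM c (ideal_gen_is_ideal _)).
by apply: sub_ideal_gen; rewrite !inE.
Qed.

(** Krull's argument: an ideal maximal among those that contain [I] and miss the multiplicative set
    [S] is prime. *)
Lemma prime_avoiding I (S : A -> Prop) : is_ideal I ->
  S 1 -> (forall u v, S u -> S v -> S (u * v)) -> (forall u, I u -> ~ S u) ->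
  exists P, [/\ is_prime P, (forall u, I u -> P u) & (forall u, P u -> ~ S u)].
Proof.
move=> hI S1 SM IS.
pose Q (X : set A) := X = set0 \/
  [/\ is_ideal X, (forall u, I u -> X u) & (forall u, X u -> ~ S u)].
have [|X [QX maxX]] := @Zorn_bigcup A Q.
  move=> F FQ tot.
  case: (pselect (exists2 X, F X & X != set0)) => [[X0 FX0 X00]|no]; last first.
    left; rewrite -subset0 => z [X FX Xz]; apply: no; exists X => //.
    by apply/set0P; exists z.
  right.
  have QF X z : F X -> X z ->
      [/\ is_ideal X, (forall u, I u -> X u) & (forall u, X u -> ~ S u)].
    by move=> /FQ[->|].
  have /set0P[z0 X0z] := X00.
  have [hX0 IX0 _] := QF _ _ FX0 X0z.
  split.
  - split; first by exists X0 => //; exact: (ideal0 _).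
    move=> c u v [X FX Xu] [Y FY Yv].
    have [hX _ _] := QF _ _ FX Xu; have [hY _ _] := QF _ _ FY Yv.
    case: (tot _ _ FX FY) => [XY|YX].
      by exists Y => //; apply hY => //; apply: XY.
    by exists X => //; apply hX => //; apply: YX.
  - by move=> u Iu; exists X0 => //; apply: IX0.
  - by move=> u [X FX Xu]; case: (QF _ _ FX Xu) => _ _; apply.
(* A maximal set is not empty, since [I] would be strictly larger. *)
case: QX => [X0|[hX IX XS]].
  exfalso; apply: (maxX I); last by right; split.
  rewrite X0; split; first exact: sub0set.
  by move=> /(_ 0 (ideal0 hI)).
exists X; split=> //; split=> // [X1|u v Xuv]; first exact: (XS 1).
apply: contrapT => /not_orP[Xu Xv].
(* By maximality, the ideal generated by [X] and an element outside [X] meets [S]. *)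
have meet w : ~ X w -> exists2 s, S s & exists c, X (s - c * w).
  move=> Xw; apply: contrapT => no.
  pose Y : set A := fun z => exists c, X (z - c * w).
  apply: (maxX Y).
    split; last first.
      by move=> /(_ w) h; apply/Xw/h; exists 1; rewrite mul1r subrr; apply hX.
    by move=> z Xz; exists 0; rewrite mul0r subr0.
  right; split.
  - split; first by exists 0; rewrite mul0r subr0; apply hX.
    move=> c a b [d Xa] [e Xb]; exists (c * d + e).
    have -> : c * a + b - (c * d + e) * w = c * (a - d * w) + (b - e * w) by ring.
    by apply hX.
  - by move=> z Iz; exists 0; rewrite mul0r subr0; apply: IX.
  - by move=> z [c Xz] Sz; apply: no; exists z => //; exists c.
have [s Ss [c Xs]] := meet u Xu; have [t St [d Xt]] := meet v Xv.
apply: (XS (s * t)); last exact: SM.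
have -> : s * t = t * (s - c * u) + (c * u * (t - d * v) + c * d * (u * v)) by ring.
apply: (idealD hX); first exact: idealM.
by apply: (idealD hX); apply: (idealM _ hX).
Qed.

Lemma prime_above I : is_ideal I -> ~ I 1 ->
  exists2 P, is_prime P & forall u, I u -> P u.
Proof.
move=> hI I1.
have [|||P [hP IP _]] := @prime_avoiding I (fun z => z = 1) hI; [by []| | |].
- by move=> u v -> ->; rewrite mul1r.
- by move=> u Iu u1; apply: I1; rewrite -u1.
- by exists P.
Qed.

(** The products z^n s with s outside [P] form a multiplicative set, which misses [I] because [z] is
    a nonzerodivisor modulo [I]. A prime avoiding it lies in [P] and omits [z]. *)
Lemma prime_below I P z : is_ideal I -> is_prime P -> (forall u, I u -> P u) ->
  P z -> (forall s, I (z * s) -> I s) ->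
  exists Q, [/\ is_prime Q, (forall u, I u -> Q u), (forall u, Q u -> P u) & ~ Q z].
Proof.
move=> hI hP IP Pz zreg.
have zregX n s : I (z ^+ n * s) -> I s.
  by elim: n s => [|n IH] s; rewrite ?mul1r // exprSr -mulrA => /IH/zreg.
pose S u := exists n s, ~ P s /\ u = z ^+ n * s.
have [|||Q [hQ IQ QS]] := @prime_avoiding I S hI.
- by exists 0%N, 1; split; [case: hP | rewrite mul1r].
- move=> _ _ [n [s [Ps ->]]] [m [t [Pt ->]]]; exists (n + m)%N, (s * t).
  by split; [exact: primeM | rewrite exprD; ring].
- by move=> _ /[swap] -[n [s [Ps ->]]] /zregX/IP.
exists Q; split=> // [u Qu|Qz].
  apply: contrapT => Pu; apply: (QS u Qu); exists 0%N, u; by rewrite mul1r.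
by apply: (QS z Qz); exists 1%N, 1; split; [case: hP | rewrite mulr1].
Qed.

(** This is the inequality between depth and dimension. The chain grows downwards from a prime
    containing the whole sequence: each use of [prime_below] adds a prime that contains the first
    [i] entries and omits the next one. *)
Lemma regular_sequence_chain (s : seq A) : regular_sequence s ->
  prime_chain A (size s).
Proof.
move=> [reg s1].
suff /(_ (size s) (leqnn _)) : forall k, (k <= size s)%N ->
    exists p : nat -> A -> Prop,
    [/\ forall i, is_prime (p i),
        forall z, z \in ideal_gen (mem (take (size s - k) s)) -> p 0%N z &
        forall i, (i < k)%N -> (forall z, p i z -> p i.+1 z) /\ exists2 z, p i.+1 z & ~ p i z].
  case=> p [pp _ chain].
  have /choice [q hq] i := is_prime_idealr (pp i).
  exists q => i /chain[sub [z pz npz]]; split.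
    by move=> u /hq/sub/hq.
  by move=> h; apply: npz; apply/hq; apply: h; apply/hq.
elim=> [|k IH] ks.
  have [||P hP sP] := @prime_above (fun z => z \in ideal_gen (mem s)).
  - exact: ideal_gen_is_ideal.
  - exact/negP.
  by exists (fun=> P); rewrite subn0 take_size.
have [p [pp p0 chain]] := IH (ltnW ks).
set i := (size s - k.+1)%N; have ilt : (i < size s)%N by lia.
have ei : (size s - k)%N = i.+1 by lia.
rewrite ei (take_nth 0 ilt) in p0.
have sub z : z \in ideal_gen (mem (take i s)) -> p 0%N z.
  move=> hz; apply: p0; move: z hz; apply: ideal_gen_min.
    exact: ideal_gen_is_ideal.
  by move=> z hz; apply: sub_ideal_gen; rewrite mem_rcons in_cons hz orbT.
have p0i : p 0%N s`_i.
  by apply: p0; apply: sub_ideal_gen; rewrite mem_rcons in_cons eqxx.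
have [|Q [hQ IQ Qp nQ]] :=
  prime_below (ideal_gen_is_ideal (mem (take i s))) (pp 0%N) sub p0i.
  by move=> z; rewrite mulrC; apply: reg.
exists (fun j => if j is j'.+1 then p j' else Q); split=> //; first by case.
by case=> [|j] /=; [split=> //; exists s`_i | apply: chain].
Qed.

End Ideals.

(** * Localization *)

Definition loc_map (A : comNzRingType) (P : prime_idealr A) (a : A) :
  localization P := \pi_(localization P)%qT
    (Localization.Ratio (Localization.notin1 P : (a, 1).2 \notin _)).

Section LocMap.
Variables (A : comNzRingType) (P : prime_idealr A).

Lemma loc_map_is_zmod_morphism : zmod_morphism (@loc_map A P).
Proof.
move=> u v.
rewrite -[RHS]/(Localization.add (loc_map P u) (Localization.opp (loc_map P v))).
rewrite /loc_map -Localization.pi_opp -Localization.pi_add.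
by apply: Localization.equiv_cross => /=; ring.
Qed.

Lemma loc_map_is_monoid_morphism : monoid_morphism (@loc_map A P).
Proof.
split=> [|u v]; first exact: Localization.equiv_cross.
rewrite -[RHS]/(Localization.mul (loc_map P u) (loc_map P v)) /loc_map.
rewrite -Localization.pi_mul.
by apply: Localization.equiv_cross => /=; ring.
Qed.

HB.instance Definition _ := GRing.isZmodMorphism.Build A (localization P)
  (@loc_map A P) loc_map_is_zmod_morphism.
HB.instance Definition _ := GRing.isMonoidMorphism.Build A (localization P)
  (@loc_map A P) loc_map_is_monoid_morphism.

Lemma loc_map_frac (z : localization P) : exists s f,
  s \notin (P : {pred A}) /\ loc_map P s * z = loc_map P f.
Proof.
elim/quotW: z => u; exists (Localization.frac u).2, (Localization.frac u).1.
split; first exact: Localization.den_ratio.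
rewrite -[LHS]/(Localization.mul _ _) /loc_map -Localization.pi_mul.
by apply: Localization.equiv_cross => /=; ring.
Qed.

Lemma loc_map_unit s : s \notin (P : {pred A}) -> exists t, t * loc_map P s = 1.
Proof.
move=> Ps; exists (\pi_(localization P)%qT (Localization.Ratio
  (Ps : (1, s).2 \notin _))).
rewrite -[LHS]/(Localization.mul _ _) /loc_map -Localization.pi_mul.
by apply: Localization.equiv_cross => /=; ring.
Qed.

Lemma loc_map_eq0 f : loc_map P f = 0 <-> exists2 s, s \notin (P : {pred A}) & s * f = 0.
Proof.
split=> [/eqP/Localization.equivP[s sP /=]|[s sP e]].
  by rewrite mulr1 mul0r subr0; exists s.
apply/eqP/Localization.equivP; exists s => //=.
by rewrite mulr1 mul0r subr0.
Qed.

End LocMap.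

(* [tau] exhibits [B] as the localization of [A / J] at the prime [P / J]. *)
Record localizes (A B : comNzRingType) (tau : A -> B) (J P : A -> Prop) := {
  loc_frac : forall z, exists s f, ~ P s /\ tau s * z = tau f;
  loc_ker : forall f, tau f = 0 <-> exists2 s, ~ P s & J (s * f);
  loc_unit : forall s, ~ P s -> exists t, t * tau s = 1
}.

Lemma localization_localizes (A : comNzRingType) (J : idealr A)
    (P : prime_idealr {ideal_quot J}) :
  exists tau : {rmorphism A -> localization P},
    localizes tau (fun f => f \in (J : {pred A}))
      (fun f => \pi_({ideal_quot J})%qT f \in (P : {pred {ideal_quot J}})).
Proof.
exists (@loc_map _ P \o \pi_({ideal_quot J})%qT); split=> /=.
- move=> z; have [s [f [Ps e]]] := loc_map_frac z.
  exists (repr s), (repr f); rewrite !reprK; split=> //; exact/negP.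
- move=> f; split.
    case/loc_map_eq0=> s Ps e; exists (repr s); first by rewrite reprK; apply/negP.
    rewrite -[X in X * _]reprK -rmorphM in e; move/eqP: e.
    by rewrite -(rmorph0 (\pi_({ideal_quot J})%qT)) -Quotient.idealrBE subr0.
  case=> s /negP Ps Js; apply/loc_map_eq0; exists (\pi_({ideal_quot J})%qT s) => //.
  rewrite -rmorphM; apply/eqP; rewrite -(rmorph0 (\pi_({ideal_quot J})%qT)).
  by rewrite -Quotient.idealrBE subr0.
- by move=> s /negP; apply: loc_map_unit.
Qed.

Lemma pi_prime (A : comNzRingType) (J : idealr A) (P : prime_idealr {ideal_quot J}) :
  is_prime (fun f => \pi_({ideal_quot J})%qT f \in (P : {pred {ideal_quot J}})).
Proof.
have [hP P1 dv] := prime_idealr_is_prime P.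
split; first split.
- by rewrite rmorph0; apply: ideal0 hP.
- by move=> c u v Pu Pv; rewrite rmorphD rmorphM; apply hP.
- by rewrite rmorph1.
- by move=> u v; rewrite rmorphM; apply: dv.
Qed.

Lemma pi_sub (A : comNzRingType) (J : idealr A) (P : prime_idealr {ideal_quot J}) f :
  f \in (J : {pred A}) -> \pi_({ideal_quot J})%qT f \in (P : {pred {ideal_quot J}}).
Proof.
move=> Jf; have -> : \pi_({ideal_quot J})%qT f = 0.
  by apply/eqP; rewrite -(rmorph0 (\pi_({ideal_quot J})%qT)) -Quotient.idealrBE subr0.
exact: idealr0.
Qed.

Lemma nonunits_local (B : comNzRingType) (M : B -> Prop) : is_ideal M -> ~ M 1 ->
  (forall z, ~ M z -> exists t, t * z = 1) ->
  local_with ([pred z | `[< M z >]] : {pred B}).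
Proof.
move=> hM M1 units; have cM := is_ideal_closed hM M1.
have sub (I : {pred B}) : idealr_closed I ->
    {subset I <= ([pred z | `[< M z >]] : {pred B})}.
  move=> hI z Iz; apply/asboolT; apply: contrapT => /units[t tz].
  have [_ /negP I1 _] := hI; apply: I1; rewrite -tz.
  exact: (idealM t (idealr_closed_is_ideal hI)).
split; first by split=> // I hI _; apply: sub.
move=> I [hI maxI] z; apply/idP/idP; first exact: sub.
by apply: maxI => //; apply: sub.
Qed.

(** Regular sequences give chains of the same length, so the bound on chains settles both the
    dimension and the depth. *)
Lemma local_cm (B : comNzRingType) (M : {pred B}) (s : seq B) : local_with M ->
  {subset s <= M} -> regular_sequence s ->
  (forall e, prime_chain B e -> (e <= size s)%N) -> cohen_macaulay_local B.
Proof.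
move=> locM sM reg dim; exists M; split=> //; exists (size s); split; last first.
  by split=> //; apply: regular_sequence_chain.
split; first by exists s.
by move=> e [t [<- _ /regular_sequence_chain/dim]].
Qed.

Section Localizes.
Variables (A B : comNzRingType) (tau : {rmorphism A -> B}) (J P : A -> Prop).
Hypothesis hP : is_prime P.
Hypothesis JP : forall f, J f -> P f.
Hypothesis loc : localizes tau J P.

(** The extension of an ideal [Q] to [B], described by fractions with numerator in [Q] in place of
    sums of products. *)
Definition loc_ext (Q : A -> Prop) (z : B) :=
  exists s f, [/\ ~ P s, Q f & tau s * z = tau f].

Lemma loc_cancel s (z w : B) : ~ P s -> tau s * z = tau s * w -> z = w.
Proof.
move=> /(loc_unit loc)[t ts] e.
by rewrite -[z]mul1r -[w]mul1r -ts -!mulrA e.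
Qed.

Lemma loc_eq f g : tau f = tau g <-> exists2 s, ~ P s & J (s * f - s * g).
Proof.
have -> : tau f = tau g <-> tau (f - g) = 0.
  by rewrite rmorphB; split=> [->|/subr0_eq //]; rewrite subrr.
rewrite (loc_ker loc).
by split=> -[s Ps Js]; exists s => //; rewrite -mulrBr in Js *.
Qed.

Lemma loc0 f : J f -> tau f = 0.
Proof. by move=> Jf; apply/(loc_ker loc); exists 1; rewrite ?mul1r //; case: hP. Qed.

Section Extension.
Variable Q : A -> Prop.
Hypothesis hQ : is_prime Q.
Hypothesis JQ : forall f, J f -> Q f.
Hypothesis QP : forall f, Q f -> P f.

(** Denominators lie outside [P], hence outside [Q], and cancel because [Q] is prime. *)
Lemma loc_extE f : loc_ext Q (tau f) <-> Q f.
Proof.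
split; last first.
  by move=> Qf; exists 1, f; rewrite rmorph1 mul1r; split=> //; case: hP.
case=> s [g [Ps Qg]]; rewrite -rmorphM => /loc_eq[t Pt /JQ].
have hI := prime_ideal hQ.
move=> h; have {}h : Q (t * (s * f)).
  by rewrite -[t * (s * f)](subrK (t * g)); apply: (idealD hI) => //; apply: (idealM _ hI).
have [_ _ dv] := hQ.
by case/dv: h => [/QP//|]; case/dv=> // /QP.
Qed.

Lemma loc_ext_prime : is_prime (loc_ext Q).
Proof.
have hI := prime_ideal hQ.
split; first split.
- by rewrite -(rmorph0 tau); apply/loc_extE; apply: ideal0.
- move=> c u v [s [f [Ps Qf es]]] [t [g [Pt Qg et]]].
  have [r [h [Pr er]]] := loc_frac loc c.
  exists (r * s * t), (h * f * t + r * s * g); split.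
  + by apply: primeM => //; apply: primeM.
  + by apply: (idealD hI); [apply: (idealMl _ hI)|]; apply: (idealM _ hI).
  + rewrite !(rmorphM, rmorphD) /= -er -es -et; ring.
- by rewrite -(rmorph1 tau) => /loc_extE; case: hQ.
- move=> u v [s [f [Ps Qf e]]].
  have [r [h [Pr er]]] := loc_frac loc u; have [t [g [Pt et]]] := loc_frac loc v.
  have : loc_ext Q (tau (h * g)).
    exists s, (r * t * f); split=> //; first exact: (idealM _ hI).
    by rewrite !rmorphM /= -e -er -et; ring.
  move/loc_extE; case: (hQ) => _ _ dv /dv[Qh|Qg]; [left|right].
    by exists r, h.
  by exists t, g.
Qed.

End Extension.

Lemma loc_local : local_with ([pred z | `[< loc_ext P z >]] : {pred B}).
Proof.
have [hI M1 _] := loc_ext_prime hP JP (fun f Pf => Pf).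
apply: nonunits_local => // z nz.
have [s [f [Ps e]]] := loc_frac loc z.
case: (pselect (P f)) => [Pf|/(loc_unit loc)[t tf]]; first by case: nz; exists s, f.
by exists (t * tau s); rewrite -mulrA e.
Qed.

(** Primes are contracted along [tau]. Inclusions stay strict because a separating element,
    multiplied by a unit, is the image of an element of [A]. *)
Lemma loc_chain_pull e : prime_chain B e -> exists p : nat -> A -> Prop,
  [/\ forall i, is_prime (p i), forall i f, J f -> p i f &
      forall i, (i < e)%N ->
       (forall f, p i f -> p i.+1 f) /\ exists2 f, p i.+1 f & ~ p i f].
Proof.
case=> p chain; exists (fun i f => tau f \in (p i : {pred B})).
have hp i := prime_idealr_is_prime (p i).
split.
- move=> i; have [hI p1 dv] := hp i; split.
  + split; first by rewrite rmorph0; apply: (ideal0 hI).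
    by move=> c u v pu pv; rewrite rmorphD rmorphM; apply hI.
  + by rewrite rmorph1.
  + by move=> u v; rewrite rmorphM; apply: dv.
- by move=> i f /loc0 ->; apply: (ideal0 (prime_ideal (hp i))).
- move=> i /chain[sub nsub]; split=> [f|]; first exact: sub.
  have [z pz npz] : exists2 z, z \in (p i.+1 : {pred B}) & z \notin (p i : {pred B}).
    apply: contrapT => no; apply: nsub => z pz; apply/negPn/negP => npz.
    by apply: no; exists z.
  have [s [f [Ps e1]]] := loc_frac loc z; have [t ts] := loc_unit loc Ps.
  exists f; first by rewrite -e1; apply: (idealM _ (prime_ideal (hp _))).
  rewrite -e1 => h; case/negP: npz; rewrite -[z]mul1r -ts -mulrA.
  exact: (idealM _ (prime_ideal (hp _))).
Qed.

Lemma loc_chain_push e (p : nat -> A -> Prop) :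
  (forall i, [/\ is_prime (p i), forall f, J f -> p i f & forall f, p i f -> P f]) ->
  (forall i, (i < e)%N ->
     (forall f, p i f -> p i.+1 f) /\ exists2 f, p i.+1 f & ~ p i f) ->
  prime_chain B e.
Proof.
move=> hp chain.
have /choice [q hq] i : exists Q : prime_idealr B,
    forall z, z \in (Q : {pred B}) <-> loc_ext (p i) z.
  by apply: is_prime_idealr; have [? ? ?] := hp i; apply: loc_ext_prime.
exists q => i /chain[sub [f pf npf]]; split.
  by move=> z /hq[s [g [? /sub ? ?]]]; apply/hq; exists s, g.
have [h1 h2 h3] := hp i; have [h4 h5 h6] := hp i.+1.
move=> /(_ (tau f)) h; apply: npf; apply/(loc_extE h1) => //.
by apply/hq; apply: h; apply/hq; apply/loc_extE.
Qed.

(** Denominators become units, so regularity modulo [J] survives localization; membership of [F] and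
    [G] in [P] keeps the sequence proper. *)
Lemma loc_regular2 (F G : A) : P F -> P G ->
  (forall z, J (F * z) -> J z) ->
  (forall z w, J (G * z - F * w) -> exists w', J (z - F * w')) ->
  regular_sequence [:: tau F; tau G] /\
  {subset [:: tau F; tau G] <= ([pred z | `[< loc_ext P z >]] : {pred B})}.
Proof.
move=> PF PG regF regG.
have sub : {subset [:: tau F; tau G] <= ([pred z | `[< loc_ext P z >]] : {pred B})}.
  by move=> z; rewrite !in_cons in_nil orbF => /orP[]/eqP ->; apply/asboolT/loc_extE.
split=> //; split; last first.
  have [hI M1 _] := loc_ext_prime hP JP (fun f Pf => Pf).
  apply/negP => h; apply: M1; move: h; apply: ideal_gen_min => // z /sub.
  by move/asboolP.
case=> [|[|//]] z _ /=.
  move/ideal_gen_nil => e; apply/ideal_gen_nil.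
  have [s [f [Ps es]]] := loc_frac loc z; apply: (loc_cancel Ps).
  rewrite mulr0 es; apply/(loc_ker loc).
  have : tau (f * F) = 0 by rewrite rmorphM /= -es -mulrA e mulr0.
  case/(loc_ker loc) => t Pt Jt; exists t => //; apply: regF.
  by rewrite mulrC -mulrA.
move=> /ideal_gen_seq1[c e]; apply/ideal_gen_seq1.
have [s [f [Ps es]]] := loc_frac loc z; have [t [h [Pt et]]] := loc_frac loc c.
have : tau (t * f * G) = tau (s * h * F).
  rewrite !rmorphM /= -es -et.
  transitivity (tau t * tau s * (z * tau G)); first by ring.
  by rewrite e; ring.
case/loc_eq => r Pr Jr.
have [|w Jw] := regG (r * (t * f)) (r * (s * h)).
  by move: Jr; congr (J _); ring.
have Pts : ~ P (r * t * s) by do !apply: primeM.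
have [u eu] := loc_unit loc Pts.
exists (u * tau w); rewrite -[z]mul1r -eu.
have /eqP := loc0 Jw; rewrite rmorphB subr_eq0 => /eqP.
rewrite !rmorphM /= -es => e2.
transitivity (u * (tau r * (tau t * (tau s * z)))); first by ring.
by rewrite e2; ring.
Qed.

(** Dimension at least 2 forces depth at least 2, and [F], [G] are numerators of the first two
    entries of a longest regular sequence. The factor [s] remains because equality in [B] is
    equality modulo [J] only up to such a factor. *)
Lemma loc_cm_regular2 : cohen_macaulay_local B -> prime_chain B 2 ->
  exists F G, [/\ P F, P G,
    forall z, J (F * z) -> exists2 s, ~ P s & J (s * z) &
    forall z w, J (G * z - F * w) ->
      exists s w', ~ P s /\ J (s * z - F * w')].
Proof.
case=> M [[maxM uniqM] [d [[[s [ss sM [reg _]]] _] [_ dim]]]] /dim d2.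
have lMP z : z \in M -> loc_ext P z.
  have [maxP _] := loc_local.
  by rewrite -(uniqM _ maxP) => /asboolP.
have Ms i : (i < d)%N -> loc_ext P s`_i.
  by move=> id; apply/lMP/sM/mem_nth; rewrite ss.
have [s1 [F [Ps1 PF e1]]] := Ms 0%N (ltnW d2).
have [s2 [G [Ps2 PG e2]]] := Ms 1%N d2.
exists F, G; split=> //.
- move=> z /loc0; rewrite rmorphM /= -e1 => e.
  apply/(loc_ker loc); apply/(ideal_gen_nil (tau z)).
  have := reg 0%N (tau z); rewrite take0; apply; first by rewrite ss ltnW.
  apply/ideal_gen_nil; apply: (loc_cancel Ps1); rewrite mulr0.
  by transitivity (tau s1 * s`_0 * tau z); [ring | exact: e].
- move=> z w /loc0; rewrite rmorphB !rmorphM /= => /subr0_eq.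
  rewrite -e1 -e2 => e.
  have et : take 1 s = [:: s`_0] by case: (s) ss d2 => [<-//|a l] /= _ _; rewrite take0.
  have [c ec] : exists c, tau s2 * tau z = c * s`_0.
    apply/ideal_gen_seq1; rewrite -et; apply: reg; first by rewrite ss.
    rewrite et; apply/ideal_gen_seq1; exists (tau s1 * tau w).
    by transitivity (tau s2 * s`_1 * tau z); [ring | rewrite e; ring].
  have [t [h [Pt et']]] := loc_frac loc c.
  have : tau (t * s1 * s2 * z) = tau (h * F).
    rewrite !rmorphM /= -e1 -et'.
    transitivity (tau t * tau s1 * (tau s2 * tau z)); first by ring.
    by rewrite ec; ring.
  case/loc_eq=> r Pr Jr; exists (r * (t * s1 * s2)), (r * h); split.
    by do !apply: primeM.
  by move: Jr; congr (J _); ring.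
Qed.

End Localizes.

(** * Monomial ideals *)

Section Monomial.
Variables (K : fieldType) (n : nat).
Implicit Types (U V : 'X_{1..n} -> Prop) (f g : {mpoly K[n]}) (m u : 'X_{1..n}).

Definition upset U := forall m m', U m -> U (m + m')%MM.

(** For an upset [U] this is the monomial ideal spanned by the monomials with exponents in [U]. *)
Definition mon U f := forall m, m \in msupp f -> U m.

Lemma monE U f : mon U f <-> forall m, f@_m != 0 -> U m.
Proof. by split=> h m; [rewrite -mcoeff_msupp | rewrite mcoeff_msupp]; apply: h. Qed.

Lemma mon_coef0 U f m : mon U f -> ~ U m -> f@_m = 0.
Proof. by move=> /monE h Um; apply: contrapT => /eqP/h. Qed.

Lemma eq_mon U V f : (forall m, U m <-> V m) -> mon U f <-> mon V f.
Proof. by move=> h; split=> hf m /hf/h. Qed.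

Lemma mon_add U f g : mon U f -> mon U g -> mon U (f + g).
Proof.
by move=> hf hg m /msuppD_le; rewrite mem_cat => /orP[/hf|/hg].
Qed.

Lemma mon_sumset U V f g : mon U f -> mon V g ->
  mon (fun m => exists m1 m2, [/\ U m1, V m2 & m = m1 + m2]%MM) (f * g).
Proof.
move=> hf hg m /msuppM_le/allpairsP[[m1 m2] /= [h1 h2 ->]].
by exists m1, m2; split=> //; [apply: hf | apply: hg].
Qed.

Lemma mon_ideal U : upset U -> is_ideal (mon U).
Proof.
move=> upU; split; first by move=> m; rewrite mcoeff_msupp mcoeff0 eqxx.
move=> c f g hf hg; apply: mon_add => // m.
case/(@mon_sumset (fun=> True) U) => // m1 [m2 [_ h ->]].
by rewrite addmC; apply: upU.
Qed.

Lemma monX U m : mon U 'X_[m] <-> U m.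
Proof.
split=> [h|Um m' /mem_msuppXP <- //]; apply: h; exact/mem_msuppXP.
Qed.

(** For an upset [U] with ideal I, the shifted condition on the right describes the colon ideal I :
    X^u. *)
Lemma mon_mulX U f u : mon U (f * 'X_[u]) <-> mon (fun m => U (m + u)%MM) f.
Proof.
split=> h m.
  by move=> mf; apply: h; rewrite mcoeff_msupp addmC mcoeffMX -mcoeff_msupp.
by rewrite (perm_mem (msuppMX f u)) => /mapP[m' mf ->]; rewrite addmC; apply: h.
Qed.

Lemma mon_min U (I : {mpoly K[n]} -> Prop) f : is_ideal I ->
  (forall m, U m -> I 'X_[m]) -> mon U f -> I f.
Proof.
move=> hI h hf; rewrite [f]mpolyE; apply: ideal_sum => // m /hf/h.
by rewrite -mul_mpolyC; apply: idealM.
Qed.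

Lemma mon_setU_div U f u : upset U ->
  mon (fun m => U m \/ (u <= m)%MM) f <->
  exists g c, mon U g /\ f = g + c * 'X_[u].
Proof.
move=> upU; split.
  pose I f := exists g c, mon U g /\ f = g + c * 'X_[u] :> {mpoly K[n]}.
  apply: (@mon_min _ I).
    split; first by exists 0, 0; rewrite mul0r addr0; split=> //; apply: (mon_ideal upU).1.
    move=> c _ _ [g [d [hg ->]]] [h [e [hh ->]]].
    exists (c * g + h), (c * d + e); split; last by ring.
    exact: (mon_ideal upU).2.
  move=> m [Um|um].
    by exists 'X_[m], 0; rewrite mul0r addr0; split=> //; apply/monX.
  exists 0, 'X_[m - u]; rewrite add0r -mpolyXD submK //; split=> //.
  exact: (mon_ideal upU).1.
case=> g [c [hg ->]]; apply: mon_add; first by move=> m /hg; left.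
by apply/mon_mulX => m _; right; apply: lem_addl.
Qed.

Lemma mon_ideal_mul U V (I J : {pred {mpoly K[n]}}) : upset U -> upset V ->
  (forall f, f \in I <-> mon U f) -> (forall f, f \in J <-> mon V f) ->
  forall f, f \in ideal_mul I J <->
  mon (fun m => exists m1 m2, [/\ U m1, V m2 & m = m1 + m2]%MM) f.
Proof.
move=> upU upV hI hJ f; split.
  apply: ideal_gen_min.
    apply: mon_ideal => _ m' [m1 [m2 [h1 h2 ->]]]; exists m1, (m2 + m')%MM.
    by split=> //; [apply: upV | rewrite addmA].
  by move=> _ /asboolP[g [h [/hI hg /hJ hh ->]]]; apply: mon_sumset.
apply: (mon_min (ideal_gen_is_ideal _)).
move=> _ [m1 [m2 [h1 h2 ->]]]; apply: sub_ideal_gen; apply/asboolP.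
exists 'X_[m1], 'X_[m2]; rewrite mpolyXD; split=> //.
  by apply/hI/monX.
by apply/hJ/monX.
Qed.

(** Properness is left out, so that the unit ideal qualifies and can start the inductions. *)
Definition weakly_regular U (F G : {mpoly K[n]}) :=
  (forall z, mon U (F * z) -> mon U z) /\
  (forall z w, mon U (G * z - F * w) -> exists w', mon U (z - F * w')).

Lemma eq_weakly_regular U V F G : (forall m, U m <-> V m) ->
  weakly_regular V F G -> weakly_regular U F G.
Proof.
move=> e [h1 h2]; have eUV f := eq_mon f e.
split=> [z /eUV/h1/eUV //|z w /eUV/h2[w' /eUV h]].
by exists w'.
Qed.

Lemma weakly_regularT U F G : (forall m, U m) -> weakly_regular U F G.
Proof. by move=> h; split=> [z _ m _|z w _]; last exists 0. Qed.

(* The exact sequence 0 -> R/(I : X^u) -> R/I -> R/(I + X^u) -> 0. *)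
Lemma weakly_regular_ext U u F G : upset U ->
  weakly_regular (fun m => U (m + u)%MM) F G ->
  weakly_regular (fun m => U m \/ (u <= m)%MM) F G ->
  weakly_regular U F G.
Proof.
move=> upU [q1 q2] [s1 s2].
have hI := mon_ideal upU.
have toS f : mon U f -> mon (fun m => U m \/ (u <= m)%MM) f by move=> h m /h; left.
split=> [z Uz|z w Uz].
  have [g [c [Ug e]]] := (mon_setU_div _ u upU).1 (s1 _ (toS _ Uz)).
  rewrite e; apply: mon_add => //; apply/mon_mulX/q1/mon_mulX.
  have -> : F * c * 'X_[u] = F * z - F * g by rewrite e; ring.
  by apply: (idealB hI) => //; apply: (idealM _ hI).
(* The division is first carried out modulo I + (X^u); what remains of [z] is, up to I, a multiple
   of X^u. *)
have [w' /(mon_setU_div _ u upU)[g [c [Ug e]]]] := s2 _ _ (toS _ Uz).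
have ez : z = g + c * 'X_[u] + F * w' by rewrite -e subrK.
(* Regularity of [F] modulo I + (X^u) makes [w - G * w'] a multiple of X^u up to I, so the whole
   relation can be divided by X^u and read in the colon ideal. *)
have /(mon_setU_div _ u upU)[g2 [d [Ug2 e2]]] : 
    mon (fun m => U m \/ (u <= m)%MM) (w - G * w').
  apply: s1; apply/(mon_setU_div _ u upU).
  exists (G * g - (G * z - F * w)), (G * c); split.
    by apply: (idealB hI) => //; apply: (idealM _ hI).
  by rewrite ez; ring.
have [|v] := q2 c d.
  apply/mon_mulX.
  have -> : (G * c - F * d) * 'X_[u] = (G * z - F * w) - G * g + F * g2.
    rewrite ez -[w](subrK (G * w')) e2; ring.
  by apply: mon_add; [apply: (idealB hI) => // |]; apply: (idealM _ hI).
move/mon_mulX => Uv; exists (w' + v * 'X_[u]).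
have -> : z - F * (w' + v * 'X_[u]) = g + (c - F * v) * 'X_[u] by rewrite ez; ring.
exact: mon_add.
Qed.

End Monomial.

(** * Coordinate planes *)

(* Coefficientwise reduction modulo G1 commutes with multiplication by G2, whose
   coefficients are constants. *)
Lemma poly2_regular (K : fieldType) (G1 G2 : {poly K}) (z w : {poly {poly K}}) :
  G2 != 0 -> map_poly polyC G2 * z = G1%:P * w -> exists w', z = G1%:P * w'.
Proof.
move=> G20 e; pose Z := map_poly (fun c => c %% G1) z.
pose Q := map_poly (fun c => c %/ G1) z.
have ez : z = G1%:P * Q + Z.
  apply/polyP => i; rewrite coefD coefCM !coef_map_id0 ?mod0p ?div0p //.
  by rewrite mulrC -divp_eq.
suff Z0 : Z = 0 by exists Q; rewrite ez Z0 addr0.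
have : map_poly polyC G2 * Z = 0.
  apply/polyP => k; rewrite coef0 coefM.
  transitivity ((map_poly polyC G2 * z)`_k %% G1); last first.
    by rewrite e coefCM mulrC modp_mull.
  rewrite coefM (big_morph (fun p => p %% G1) (modpD G1) (mod0p G1)).
  apply: eq_bigr => i _; rewrite coef_map coef_map_id0 ?mod0p //=.
  by rewrite !mul_polyC modpZl.
by move/eqP; rewrite mulf_eq0 map_polyC_eq0 (negbTE G20) => /eqP.
Qed.

(** The elements [f] with [f - rho f] in [I] are closed under sums and products, so the generators
    suffice. *)
Lemma mpoly_congr (K : fieldType) (n : nat) (I : {mpoly K[n]} -> Prop)
    (rho : {rmorphism {mpoly K[n]} -> {mpoly K[n]}}) : is_ideal I ->
  (forall c, rho c%:MP = c%:MP) -> (forall i, I ('X_i - rho 'X_i)) ->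
  forall f, I (f - rho f).
Proof.
move=> hI CC CX.
have CD g h : I (g - rho g) -> I (h - rho h) -> I (g + h - rho (g + h)).
  move=> Cg Ch; rewrite rmorphD opprD addrACA; exact: idealD hI Cg Ch.
have CM g h : I (g - rho g) -> I (h - rho h) -> I (g * h - rho (g * h)).
  move=> Cg Ch; rewrite rmorphM.
  have -> : g * h - rho g * rho h = g * (h - rho h) + rho h * (g - rho g) by ring.
  by apply: (idealD hI); apply: (idealM _ hI).
have C0 c : I (c%:MP - rho c%:MP) by rewrite CC subrr; apply: ideal0 hI.
elim/mpolyind=> [|c m p _ _ IH]; first by move: (C0 0); rewrite mpolyC0.
apply: CD IH; rewrite -mul_mpolyC; apply: (CM) => //.
rewrite mpolyXE_id; elim/big_ind: _ => [||i _]; first by rewrite rmorph1 subrr; apply: ideal0 hI.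
  exact: CM.
by elim: (m i) => [|k IHk]; [rewrite rmorph1 subrr; apply: ideal0 hI | rewrite exprS; apply: CM].
Qed.

Section Plane.
Variables (K : fieldType) (n : nat) (v1 v2 v3 v4 : 'I_n).
Hypothesis v_uniq : uniq [:: v1; v2; v3; v4].
Hypothesis v_all : forall i, i \in [:: v1; v2; v3; v4].

Definition plane_vars (i : 'I_n) : {poly {poly K}} :=
  if i == v3 then 'X%:P else if i == v4 then 'X else 0.

Definition to_plane : {rmorphism {mpoly K[n]} -> {poly {poly K}}} :=
  mmap (polyC \o polyC) plane_vars.

Definition of_plane : {rmorphism {poly {poly K}} -> {mpoly K[n]}} :=
  horner_eval 'X_v4 \o map_poly (horner_eval 'X_v3 \o map_poly (@mpolyC n K)).

Definition off_plane (m : 'X_{1..n}) := (0 < m v1)%N \/ (0 < m v2)%N.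

Lemma plane_neq : [/\ v1 != v3, v1 != v4, v2 != v3, v2 != v4 & v4 != v3].
Proof.
move: v_uniq; rewrite /= !in_cons !negb_or in_nil !andbT.
by case/and3P=> /and3P[_ -> ->] /andP[-> ->]; rewrite eq_sym.
Qed.

Lemma to_planeX i : to_plane 'X_i = plane_vars i.
Proof. by rewrite /= mmapX mmap1U. Qed.

Lemma to_planeC c : to_plane c%:MP = c%:P%:P.
Proof. by rewrite /= mmapC. Qed.

Lemma to_plane_horner (c : {poly K}) t :
  to_plane (map_poly (@mpolyC n K) c).[t] = (map_poly (polyC \o polyC) c).[to_plane t].
Proof.
rewrite -horner_map -map_poly_comp; congr (_.[_]).
by apply: eq_map_poly => z; rewrite /= mmapC.
Qed.

Lemma horner_polyCC (c : {poly K}) : (map_poly (polyC \o polyC) c).['X%:P] = c%:P.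
Proof. by rewrite map_poly_comp horner_map -/(comp_poly _ _) comp_polyXr. Qed.

Lemma horner_polyCX (c : {poly K}) : (map_poly (polyC \o polyC) c).['X] = map_poly polyC c.
Proof. by rewrite map_poly_comp -/(comp_poly _ _) comp_polyXr. Qed.

Lemma of_planeK : cancel of_plane to_plane.
Proof.
move=> h; rewrite /of_plane [in LHS]/= /horner_eval -horner_map to_planeX -map_poly_comp.
have [_ _ _ _ /negbTE v43] := plane_neq.
rewrite /plane_vars v43 eqxx -[RHS]comp_polyXr; congr (_.[_]).
apply: eq_map_poly => c; rewrite [LHS]to_plane_horner to_planeX /plane_vars eqxx.
exact: horner_polyCC.
Qed.

Lemma of_planeC (c : K) : of_plane c%:P%:P = c%:MP.
Proof. by rewrite /= {1}/horner_eval map_polyC hornerC /= /horner_eval map_polyC hornerC. Qed.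

Lemma of_planeY : of_plane 'X = 'X_v4.
Proof. by rewrite /= {1}/horner_eval map_polyX hornerX. Qed.

Lemma of_planeX : of_plane 'X%:P = 'X_v3.
Proof.
by rewrite /= {1}/horner_eval map_polyC hornerC /= /horner_eval map_polyX hornerX.
Qed.

Lemma off_plane_upset : upset off_plane.
Proof. by move=> m m'; rewrite /off_plane !mnmDE; lia. Qed.

Lemma of_plane_mod f : mon off_plane (f - of_plane (to_plane f)).
Proof.
have hI := mon_ideal K off_plane_upset.
apply: (mpoly_congr (rho := of_plane \o to_plane) hI) => [c|i].
  exact: etrans (congr1 of_plane (to_planeC c)) (of_planeC c).
suff : mon off_plane ('X_i - of_plane (to_plane 'X_i)) by [].
have [/negbTE n13 /negbTE n14 /negbTE n23 /negbTE n24 /negbTE n43] := plane_neq.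
rewrite to_planeX /plane_vars.
have := v_all i; rewrite !in_cons in_nil orbF => /or4P[]/eqP ->.
- rewrite n13 n14 rmorph0 subr0; apply/monX; left; by rewrite mnm1E eqxx.
- rewrite n23 n24 rmorph0 subr0; apply/monX; right; by rewrite mnm1E eqxx.
- by rewrite eqxx of_planeX subrr; apply: ideal0 hI.
- by rewrite n43 eqxx of_planeY subrr; apply: ideal0 hI.
Qed.

(** Since [of_plane] recovers [f] modulo the ideal of [v1] and [v2], [to_plane] identifies the
    quotient by that ideal with a polynomial ring in two variables. *)
Lemma to_plane_eq0 f : to_plane f = 0 <-> mon off_plane f.
Proof.
split=> [e|]; first by have := @of_plane_mod f; rewrite e rmorph0 subr0.
apply: (@mon_min _ _ _ (fun f => to_plane f = 0)).
  split; first exact: rmorph0.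
  by move=> c u v eu ev; rewrite rmorphD rmorphM eu ev mulr0 addr0.
have [/negbTE n13 /negbTE n14 /negbTE n23 /negbTE n24 _] := plane_neq.
move=> m [h|h]; [have /submK <- : (U_(v1) <= m)%MM by rewrite lep1mP -lt0n
                |have /submK <- : (U_(v2) <= m)%MM by rewrite lep1mP -lt0n];
  rewrite mpolyXD rmorphM to_planeX /plane_vars ?n13 ?n14 ?n23 ?n24; exact: mulr0.
Qed.

(** Whichever end of an edge vanishes on the plane, the sum of its two ends restricts to the other
    one. This is why a + x and b + y serve as parameters on all planes at once. *)
Lemma to_plane_polyX (c : {poly K}) :
  to_plane (map_poly (@mpolyC n K) c).['X_v1 + 'X_v3] = c%:P.
Proof.
have [/negbTE n13 /negbTE n14 _ _ _] := plane_neq.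
rewrite to_plane_horner rmorphD !to_planeX /plane_vars eqxx n13 n14 add0r.
exact: horner_polyCC.
Qed.

Lemma to_plane_polyY (c : {poly K}) :
  to_plane (map_poly (@mpolyC n K) c).['X_v2 + 'X_v4] = map_poly polyC c.
Proof.
have [_ _ /negbTE n23 /negbTE n24 /negbTE n43] := plane_neq.
rewrite to_plane_horner rmorphD !to_planeX /plane_vars eqxx n23 n24 n43 add0r.
exact: horner_polyCX.
Qed.

Lemma plane_regular (G1 G2 : {poly K}) : G1 != 0 -> G2 != 0 ->
  weakly_regular off_plane
    (map_poly (@mpolyC n K) G1).['X_v1 + 'X_v3] (map_poly (@mpolyC n K) G2).['X_v2 + 'X_v4].
Proof.
move=> G10 G20; split=> [z|z w] /to_plane_eq0.
  rewrite rmorphM to_plane_polyX => /eqP; rewrite mulf_eq0 polyC_eq0 (negbTE G10) => /eqP.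
  by move/to_plane_eq0.
rewrite rmorphB !rmorphM to_plane_polyX to_plane_polyY.
move=> /subr0_eq /(poly2_regular G20)[w' e].
exists (of_plane w'); apply/to_plane_eq0.
by rewrite rmorphB rmorphM to_plane_polyX of_planeK e subrr.
Qed.

(** A colon by [v1] lowers [d], while adding [v1] reduces to [d = 1]; the same with [v2] then
    reduces to the prime ideal of the plane. *)
Lemma plane_power_regular (G1 G2 : {poly K}) (d e : nat) : G1 != 0 -> G2 != 0 ->
  weakly_regular (fun m => (d <= m v1)%N \/ (e <= m v2)%N)
    (map_poly (@mpolyC n K) G1).['X_v1 + 'X_v3] (map_poly (@mpolyC n K) G2).['X_v2 + 'X_v4].
Proof.
move=> G10 G20.
have v12 : (v1 == v2) = false.
  by move: v_uniq; rewrite /= in_cons negb_or => /andP[/andP[/negbTE]].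
have v21 : (v2 == v1) = false by rewrite eq_sym.
have up d' e' : upset (fun m : 'X_{1..n} => (d' <= m v1)%N \/ (e' <= m v2)%N).
  by move=> m m'; rewrite !mnmDE; lia.
elim: d => [|d IHd]; first by apply: weakly_regularT; left.
apply: (weakly_regular_ext (u := U_(v1)%MM) (up _ _)).
  apply: eq_weakly_regular IHd => m.
  by rewrite !mnmDE !mnm1E eqxx v12; lia.
elim: e {IHd} => [|e IHe]; first by apply: weakly_regularT; left; right.
apply: (weakly_regular_ext (u := U_(v2)%MM)).
- move=> m m'; rewrite !lep1mP !mnmDE; lia.
- apply: eq_weakly_regular IHe => m.
  by rewrite !lep1mP !mnmDE !mnm1E eqxx v21; lia.
- apply: eq_weakly_regular (plane_regular G10 G20) => m.
  by rewrite !lep1mP /off_plane; lia.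
Qed.

End Plane.

(** * Powers of the edge ideal *)

Lemma le_mulmU n (i : 'I_n) k (m : 'X_{1..n}) : (U_(i) *+ k <= m)%MM = (k <= m i)%N.
Proof.
apply/mnm_lepP/idP => [/(_ i)|h j]; rewrite mulmnE mnm1E ?eqxx ?mul1n //.
by have [<-|_] := eqVneq i j; rewrite ?mul1n ?mul0n.
Qed.

Section Path.
Variables (K : fieldType) (n : nat) (a b x y : 'I_n) (p q r : nat).
(** The exponents of the [k]-th power: [i], [j], [l] count the factors (ab)^p, (ax)^q, (by)^r of a
    generator that divides the monomial. *)
Definition path_pow k (m : 'X_{1..n}) := exists i j l, [/\ (i + j + l = k)%N,
  (p * i + q * j <= m a)%N, (p * i + r * l <= m b)%N, (q * j <= m x)%N
  & (r * l <= m y)%N].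

Lemma path_pow_upset k : upset (path_pow k).
Proof.
move=> m m' [i [j [l [? ? ? ? ?]]]]; exists i, j, l; rewrite !mnmDE.
by split=> //; lia.
Qed.

Lemma path_pow0 m : path_pow 0 m.
Proof. by exists 0%N, 0%N, 0%N; rewrite !muln0. Qed.

Definition pairmn (u v : 'I_n) s t : 'X_{1..n} := (U_(u) *+ s + U_(v) *+ t)%MM.

Lemma pairmnE u v s t i : pairmn u v s t i = ((u == i) * s + (v == i) * t)%N.
Proof. by rewrite mnmDE !mulmnE !mnm1E. Qed.

Hypothesis abxy_uniq : uniq [:: a; b; x; y].
Hypothesis abxy_all : forall i, i \in [:: a; b; x; y].

Lemma abxy_neq : [/\ (a == b = false) * (b == a = false),
  (a == x = false) * (x == a = false), (a == y = false) * (y == a = false),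
  (b == x = false) * (x == b = false) &
  ((b == y = false) * (y == b = false)) * ((x == y = false) * (y == x = false))]%type.
Proof.
have := abxy_uniq; rewrite /= !in_cons !in_nil !orbF !negb_or !andbT.
rewrite ![b == a]eq_sym ![x == a]eq_sym ![x == b]eq_sym ![y == a]eq_sym.
rewrite ![y == b]eq_sym ![y == x]eq_sym.
by case/andP=> /and3P[/negbTE-> /negbTE-> /negbTE->] /andP[/andP[/negbTE-> /negbTE->] /negbTE->].
Qed.

(** One generator with a positive multiplicity is split off. This matches the recursion of
    [ideal_exp]. *)
Lemma path_pow_step k (m : 'X_{1..n}) : path_pow k.+1 m <-> 
  exists m1 m2, [/\ path_pow 1 m1, path_pow k m2 & m = m1 + m2]%MM.
Proof.
have [ab ax ay bx [by_ xy]] := abxy_neq.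
split; last first.
  case=> m1 [m2 [[i1 [j1 [l1 [? ? ? ? ?]]]] [i [j [l [? ? ? ? ?]]]] ->]].
  exists (i1 + i)%N, (j1 + j)%N, (l1 + l)%N; rewrite !mnmDE; split; lia.
case=> i [j [l [e ha hb hx hy]]].
have split_off u : (u <= m)%MM -> path_pow 1 u -> path_pow k (m - u)%MM ->
    exists m1 m2, [/\ path_pow 1 m1, path_pow k m2 & m = m1 + m2]%MM.
  by move=> um h1 h2; exists u, (m - u)%MM; rewrite addmC submK.
have le_pair u v s t : u != v -> (s <= m u)%N -> (t <= m v)%N -> (pairmn u v s t <= m)%MM.
  move=> uv hu hv; apply/mnm_lepP => c; rewrite pairmnE.
  have [<-|_] := eqVneq u c; first by rewrite eq_sym (negbTE uv); lia.
  by have [<-|_] := eqVneq v c; lia.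
case: i e ha hb => [|i] e ha hb.
  case: j e ha hx => [|j] e ha hx.
    case: l e hb hy => [//|l] e hb hy.
    apply: (split_off (pairmn b y r r)); first by apply: le_pair; rewrite ?by_ //; lia.
      by exists 0%N, 0%N, 1%N; rewrite !pairmnE !eqxx ?by_ //; split; lia.
    by exists 0%N, 0%N, l; rewrite !mnmBE !pairmnE !eqxx !by_ ?ab ?ay ?bx ?xy; split; lia.
  apply: (split_off (pairmn a x q q)); first by apply: le_pair; rewrite ?ax //; lia.
    by exists 0%N, 1%N, 0%N; rewrite !pairmnE !eqxx ?ax //; split; lia.
  by exists 0%N, j, l; rewrite !mnmBE !pairmnE !eqxx !ax ?ab ?ay ?bx ?xy ?by_; split; lia.
apply: (split_off (pairmn a b p p)); first by apply: le_pair; rewrite ?ab //; lia.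
  by exists 1%N, 0%N, 0%N; rewrite !pairmnE !eqxx ?ab //; split; lia.
by exists i, j, l; rewrite !mnmBE !pairmnE !eqxx !ab ?ax ?ay ?bx ?xy ?by_; split; lia.
Qed.

(** The variables [u'] and [v'] are the other ends of the edges ax and by; they are the coordinates
    of the plane where [u] and [v] vanish. *)
Lemma path_cover u v : (u == a) || (u == x) -> (v == b) || (v == y) ->
  exists u' v', [/\ uniq [:: u; v; u'; v'], (forall i, i \in [:: u; v; u'; v']),
    'X_a + 'X_x = 'X_u + 'X_u' :> {mpoly K[n]} &
    'X_b + 'X_y = 'X_v + 'X_v' :> {mpoly K[n]}].
Proof.
have [ab ax ay bx [by_ xy]] := abxy_neq.
move=> /orP[]/eqP -> /orP[]/eqP ->.
- by exists x, y.
- exists x, b; rewrite /= !in_cons !in_nil ab ax ay bx by_ xy; split=> //.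
    by move=> i; have := abxy_all i; rewrite !in_cons !in_nil; do 4!case: (i == _).
  exact: addrC.
- exists a, y; rewrite /= !in_cons !in_nil ab ax ay bx by_ xy; split=> //.
    by move=> i; have := abxy_all i; rewrite !in_cons !in_nil; do 4!case: (i == _).
  exact: addrC.
- exists a, b; rewrite /= !in_cons !in_nil ab ax ay bx by_ xy; split=> //.
  + by move=> i; have := abxy_all i; rewrite !in_cons !in_nil; do 4!case: (i == _).
  + exact: addrC.
  + exact: addrC.
Qed.

Section Regular.
Variables G1 G2 : {poly K}.
Hypotheses (G10 : G1 != 0) (G20 : G2 != 0).
Let F := (map_poly (@mpolyC n K) G1).['X_a + 'X_x].
Let G := (map_poly (@mpolyC n K) G2).['X_b + 'X_y].

Lemma path_cover_regular d e u v : (u == a) || (u == x) -> (v == b) || (v == y) ->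
  weakly_regular (fun m => (d <= m u)%N \/ (e <= m v)%N) F G.
Proof.
move=> hu hv; have [u' [v' [uniq_uv all_uv eu ev]]] := path_cover hu hv.
by rewrite /F /G eu ev; apply: plane_power_regular.
Qed.

(** The colon by a^p is (b^p, a^(d-p) x^e), as b^f y^g is absorbed by b^p; adding a^p gives (a^p,
    b^f y^g). One more colon splits each of these into ideals generated by powers of two
    variables. *)
Lemma path_three_regular d e f g : (p <= d)%N -> (p <= f)%N ->
  weakly_regular (fun m => [\/ (p <= m a)%N /\ (p <= m b)%N,
    (d <= m a)%N /\ (e <= m x)%N | (f <= m b)%N /\ (g <= m y)%N]) F G.
Proof.
have [ab ax ay bx [by_ xy]] := abxy_neq.
move=> pd pf; apply: (weakly_regular_ext (u := (U_(a) *+ p)%MM)).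
- by move=> m m'; rewrite !mnmDE => -[]?; [apply: Or31|apply: Or32|apply: Or33]; lia.
- apply: (@eq_weakly_regular _ _ _ (fun m =>
    (p <= m b)%N \/ ((d - p <= m a)%N /\ (e <= m x)%N))).
    move=> m; rewrite !mnmDE !mulmnE !mnm1E eqxx ab ax ay; split.
      by case; lia.
    by case=> h; [apply: Or31 | apply: Or32]; lia.
  apply: (weakly_regular_ext (u := (U_(a) *+ (d - p))%MM)).
  + by move=> m m'; rewrite !mnmDE; lia.
  + apply: eq_weakly_regular (path_cover_regular e p (u := x) (v := b) _ _);
      rewrite ?eqxx ?orbT // => m.
    by rewrite !mnmDE !mulmnE !mnm1E eqxx ab ax; lia.
  + apply: eq_weakly_regular (path_cover_regular (d - p) p (u := a) (v := b) _ _);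
      rewrite ?eqxx ?orbT // => m.
    by rewrite le_mulmU; lia.
- apply: (@eq_weakly_regular _ _ _ (fun m =>
    (p <= m a)%N \/ ((f <= m b)%N /\ (g <= m y)%N))).
    move=> m; rewrite le_mulmU; split; first by do 2!case; lia.
    by case=> h; [right | left; apply: Or33].
  apply: (weakly_regular_ext (u := (U_(b) *+ f)%MM)).
  + by move=> m m'; rewrite !mnmDE; lia.
  + apply: eq_weakly_regular (path_cover_regular p g (u := a) (v := y) _ _);
      rewrite ?eqxx ?orbT // => m.
    by rewrite !mnmDE !mulmnE !mnm1E eqxx ab by_; lia.
  + apply: eq_weakly_regular (path_cover_regular p f (u := a) (v := b) _ _);
      rewrite ?eqxx ?orbT // => m.
    by rewrite le_mulmU; lia.
Qed.

(* Since q, r >= 2p, the product (ax)^q (by)^r of two generators lies in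
   (ab)^p I, so that I^(k+1) : (ab)^p = I^k. *)
Lemma path_pow_colon k m : (2 * p <= q)%N -> (2 * p <= r)%N ->
  path_pow k.+1 (m + pairmn a b p p)%MM <-> path_pow k m.
Proof.
have [ab ax ay bx [by_ xy]] := abxy_neq.
move=> pq pr; split; last first.
  case=> i [j [l [? ? ? ? ?]]]; exists i.+1, j, l.
  by rewrite !mnmDE !mulmnE !mnm1E !eqxx !ab ?ax ?ay ?bx ?xy ?by_; split; lia.
case=> i [j [l []]]; rewrite !mnmDE !mulmnE !mnm1E !eqxx !ab ax ay bx by_.
case: i => [|i] e ha hb hx hy; last by exists i, j, l; split; lia.
case: j l e ha hb hx hy => [|j] [|l] e ha hb hx hy //.
(* If only one kind of factor occurs, division by (ab)^p costs at most one of them. *)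
- by exists 0%N, 0%N, l; split; lia.
- by exists 0%N, j, 0%N; split; lia.
(* One factor (ax)^q and one factor (by)^r are traded for one (ab)^p: the excesses q - p and r - p
   are at least p. *)
- by exists 1%N, j, l; split; lia.
Qed.

Lemma path_pow_regular k : (2 * p <= q)%N -> (2 * p <= r)%N ->
  weakly_regular (path_pow k) F G.
Proof.
have [ab ax ay bx [by_ xy]] := abxy_neq.
move=> pq pr; elim: k => [|k IH].
  by apply: weakly_regularT => m; apply: path_pow0.
(* The colon by (ab)^p is the previous power; adding (ab)^p leaves only the pure powers of the other
   two generators. *)
apply: (weakly_regular_ext (u := pairmn a b p p) (@path_pow_upset _)).
  by apply: eq_weakly_regular IH => m; apply: path_pow_colon.
apply: (@eq_weakly_regular _ _ _ _ _ _ _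
  (@path_three_regular (q * k.+1) (q * k.+1) (r * k.+1) (r * k.+1) _ _)); try nia.
move=> m; have -> : (pairmn a b p p <= m)%MM <-> (p <= m a)%N /\ (p <= m b)%N.
  split=> [/mnm_lepP h|[h1 h2]].
    by have := h a; have := h b; rewrite !pairmnE !eqxx ab; lia.
  apply/mnm_lepP => c; rewrite pairmnE.
  have [<-|_] := eqVneq a c; first by rewrite ab; lia.
  by have [<-|_] := eqVneq b c; lia.
split.
  case=> [[i [j [l [e ha hb hx hy]]]]|h]; last exact: Or31.
  case: i e ha hb => [|i] e ha hb; last first.
    by rewrite !mulnS in ha hb; apply: Or31; split; lia.
  rewrite !muln0 !add0n in e ha hb.
  case: j e ha hx => [|j] e ha hx.
    by apply: Or33; rewrite -e.
  case: l e hb hy => [|l] e hb hy; first by apply: Or32; rewrite -e addn0.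
  (* A product with both (ax)^q and (by)^r among its factors is divisible by (ab)^p. *)
  by rewrite !mulnS in ha hb; apply: Or31; split; lia.
case=> -[h1 h2]; [by right | left; exists 0%N, k.+1, 0%N | left; exists 0%N, 0%N, k.+1];
  by rewrite !muln0; split; lia.
Qed.

End Regular.
End Path.

(** * Zariski's lemma for two variables *)

Section Zariski.
Variables (K : fieldType) (L : comNzRingType).
Hypothesis L_field : forall z : L, z <> 0 -> exists t, t * z = 1.

Let L_domain (u v : L) : u * v = 0 -> v <> 0 -> u = 0.
Proof.
move=> uv /L_field[t tv]; rewrite -[u]mulr1 -tv.
by rewrite [t * v]mulrC mulrA uv mul0r.
Qed.

Section Integral.
Variables (eps : {rmorphism {poly {poly K}} -> L}).
Hypothesis eps_surj : forall z, exists h, eps h = z.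
Hypothesis eps_inj : forall c, eps c%:P = 0 -> c = 0.
Variable iota : {rmorphism {poly K} -> L}.
Hypothesis iotaE : forall c, iota c = eps c%:P.

Let iota_neq0 c : c != 0 -> iota c <> 0.
Proof. by rewrite iotaE; move=> c0 /eps_inj e; rewrite e eqxx in c0. Qed.

(** If [h] maps to the inverse of the image of the inner variable s, then h s - 1 is in the kernel;
    it is nonzero because its constant term is -1. *)
Lemma relation_exists : exists2 f : {poly {poly K}}, f != 0 & eps f = 0.
Proof.
have [u ue] : exists u, u * iota 'X = 1 by apply/L_field/iota_neq0; rewrite polyX_eq0.
have [h eh] := eps_surj u; exists (h * 'X%:P - 1); last first.
  by rewrite rmorphB rmorphM rmorph1 eh -iotaE ue subrr.
apply/eqP => /(congr1 (fun f : {poly {poly K}} => (f`_0).[0])).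
rewrite coefB coefMC coef1 hornerD hornerN hornerM hornerX mulr0 add0r hornerC coef0 horner0.
by move/eqP; rewrite oppr_eq0 oner_eq0.
Qed.

(** A relation of degree d with leading coefficient l, multiplied by l^(d-1), becomes a monic
    equation for l t. *)
Lemma integral_leadM (f : {poly {poly K}}) : f != 0 -> eps f = 0 ->
  integralOver iota (iota (lead_coef f) * eps 'X).
Proof.
move=> f0 ef; set l := lead_coef f; set t := eps 'X.
have ef' : \sum_(i < size f) iota f`_i * t ^+ i = 0.
  rewrite -[RHS]ef -[X in _ = eps X]coefK poly_def rmorph_sum; apply: eq_bigr => i _.
  by rewrite -mul_polyC rmorphM rmorphXn iotaE.
(* A relation that is constant in the outer variable would contradict [eps_inj]. *)
have sf : (1 < size f)%N.
  rewrite ltnNge; apply/negP => /size1_polyC e; case/eqP: f0; rewrite e.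
  by rewrite [f`_0]eps_inj // -e.
set d := (size f).-1; have ed : size f = d.+1 by rewrite /d; lia.
pose q := 'X^d + \poly_(i < d) (f`_i * l ^+ (d.-1 - i)).
exists q.
  by rewrite monicE lead_coefDl ?lead_coefXn // size_polyXn ltnS size_poly.
apply/rootP; rewrite rmorphD /= map_polyXn hornerD hornerXn.
rewrite (@horner_coef_wide _ d); last by rewrite (leq_trans (size_poly _ _)) ?size_poly.
have -> : \sum_(i < d) (map_poly iota (\poly_(i < d) (f`_i * l ^+ (d.-1 - i))))`_i *
    (iota l * t) ^+ i = iota l ^+ d.-1 * \sum_(i < d) iota f`_i * t ^+ i.
  rewrite mulr_sumr; apply: eq_bigr => i _.
  rewrite coef_map coef_poly ltn_ord /= rmorphM rmorphXn exprMn.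
  have -> : d.-1 = (d.-1 - i + i)%N by rewrite subnK //; case: i => i /=; lia.
  by rewrite addnK exprD; ring.
move: ef'; rewrite ed big_ord_recr /= => /eqP; rewrite addr_eq0 => /eqP ->.
have -> : f`_d = l by [].
have -> : d = d.-1.+1 by lia.
by rewrite exprMn /= !exprS; ring.
Qed.

(** Every element is a polynomial in t with coefficients from K[s]; each factor t is made integral
    by one factor l. *)
Lemma integral_multiple l z : integralOver iota (iota l * eps 'X) ->
  exists e, integralOver iota (iota l ^+ e * z).
Proof.
move=> int_lt; have [h <-] := eps_surj z; elim/poly_ind: h => [|h c [e IH]].
  by exists 0%N; rewrite rmorph0 mulr0; apply: integral0.
exists e.+1; rewrite rmorphD rmorphM mulrDr.
apply: integral_add.
  have -> : iota l ^+ e.+1 * (eps h * eps 'X) = (iota l ^+ e * eps h) * (iota l * eps 'X).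
    by rewrite exprS; ring.
  exact: integral_mul.
by rewrite -iotaE -rmorphXn -rmorphM; apply: integral_id.
Qed.

(** The polynomial w = 1 + l s is nonconstant and coprime to l. Its inverse becomes integral over
    K[s] after multiplication by a power of l; clearing denominators in the integral equation makes
    w divide a power of l. *)
Lemma no_injective_eps : False.
Proof.
have [f f0 ef] := relation_exists.
set l := lead_coef f; have l0 : l != 0 by rewrite lead_coef_eq0.
pose w := 1 + l * 'X : {poly K}.
have sw : (1 < size w)%N.
  rewrite /w addrC size_polyDl ?size_mulX // ?size_poly1; rewrite ltnS lt0n size_poly_eq0 //.
have w0 : w != 0 by rewrite -size_poly_eq0; lia.
have [v vw] : exists v, v * iota w = 1 by apply/L_field/iota_neq0.
have [e [g g_monic /rootP g0]] := integral_multiple v (integral_leadM f0 ef).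
set N := (size g).-1.
have sg : size g = N.+1 by rewrite /N prednK // lt0n size_poly_eq0 monic_neq0.
(* Multiplication by w^N clears the powers of the inverse [v]; every term except the leading one
   keeps a factor w. *)
have : iota w ^+ N * (map_poly iota g).[iota l ^+ e * v] = 0 by rewrite g0 mulr0.
rewrite (@horner_coef_wide _ N.+1); last by rewrite -sg size_poly.
have term i : (i <= N)%N -> iota w ^+ N * ((map_poly iota g)`_i * (iota l ^+ e * v) ^+ i) =
    iota (g`_i * l ^+ (e * i) * w ^+ (N - i)).
  move=> iN; rewrite coef_map !rmorphM !rmorphXn exprMn -exprM.
  rewrite -{1}(subnK iN) exprD.
  transitivity (iota g`_i * iota l ^+ (e * i) * iota w ^+ (N - i) * (v ^+ i * iota w ^+ i)).
    by ring.
  by rewrite -exprMn vw expr1n mulr1.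
rewrite big_ord_recr /= mulrDr mulr_sumr term // subnn.
under eq_bigr => i _ do rewrite (term i (ltnW (ltn_ord i))).
have -> : g`_N = 1 by rewrite -(eqP g_monic) lead_coefE.
rewrite -rmorph_sum -rmorphD iotaE => /eps_inj; rewrite mul1r mulr1 => /eqP.
rewrite addrC addr_eq0 => /eqP el.
have wl : w %| l ^+ (e * N).
  rewrite el dvdpNr; apply: (big_ind (fun p => w %| p)) => [||i _];
    [exact: dvdp0 | exact: dvdp_add |].
  have -> : (N - i = (N - i).-1.+1)%N by case: i => i /=; lia.
  by rewrite exprS mulrCA dvdp_mulr.
have cop : coprimep w (l ^+ (e * N)).
  apply: coprimep_expr; apply/Bezout_coprimepP; exists (1, - 'X).
  by rewrite mul1r mulNr [X in w - X]mulrC /w addrK eqpxx.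
have /(coprimepP _ _)/(_ w (dvdpp w) wl) := cop.
by rewrite -size_poly_eq1 => /eqP e1; rewrite e1 in sw.
Qed.

End Integral.

(** If no such polynomial existed for the inner variable, K[s] would embed in [L], against
    [no_injective_eps]. Exchanging the variables gives the second half. *)
Lemma zariski_plane (eps : {rmorphism {poly {poly K}} -> L}) :
  (forall z, exists h, eps h = z) ->
  (exists2 G : {poly K}, G != 0 & eps G%:P = 0) /\
  (exists2 G : {poly K}, G != 0 & eps (map_poly polyC G) = 0).
Proof.
suff main (e : {rmorphism {poly {poly K}} -> L}) : (forall z, exists h, e h = z) ->
    exists2 G : {poly K}, G != 0 & e G%:P = 0.
  move=> surj; split; first exact: main.
  have [|G G0 e] := main (eps \o @swapXY K).
    by move=> z; have [h <-] := surj z; exists (swapXY h); rewrite /= swapXYK.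
  by exists G => //; rewrite -e /= swapXY_polyC.
move=> surj; apply: contrapT => no; apply: (@no_injective_eps e surj _ (e \o polyC)) => // c ec.
by apply/eqP; apply: contrapT => /negP c0; apply: no; exists c.
Qed.

End Zariski.

(** * Krull dimension *)

Lemma left_kernel_nontrivial (F : fieldType) (S T : finType) (h : S -> T -> F) :
  (#|T| < #|S|)%N ->
  exists v : S -> F, (exists s, v s != 0) /\ forall t, \sum_s v s * h s t = 0.
Proof.
move=> cardST.
pose A := \matrix_(i < #|S|, j < #|T|) h (enum_val i) (enum_val j).
have : kermx A != 0.
  rewrite kermx_eq0 /row_free; apply: contraL cardST => /eqP <-.
  by rewrite -leqNgt rank_leq_col.
case/rowV0Pn=> v /sub_kermxP vA v0; exists (fun s => v 0 (enum_rank s)); split.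
  case/rV0Pn: v0 => i vi; exists (enum_val i); by rewrite enum_valK.
move=> t; have /rowP/(_ (enum_rank t)) := vA; rewrite !mxE => e.
rewrite -[RHS]e.
rewrite (reindex (fun i : 'I_#|S| => enum_val i)) /=; last first.
  by exists enum_rank => s _; [exact: enum_valK | exact: enum_rankK].
by apply: eq_bigr => i _; rewrite mxE enum_valK enum_rankK.
Qed.

Lemma size_monomial3 (R : comNzRingType) (f g h : {poly R}) D i j k :
  (size f <= D.+1)%N -> (size g <= D.+1)%N -> (size h <= D.+1)%N ->
  (size (f ^+ i * g ^+ j * h ^+ k)%R <= (D * (i + j + k)).+1)%N.
Proof.
have szX (u : {poly R}) l : (size u <= D.+1)%N -> (size (u ^+ l)%R <= (D * l).+1)%N.
  move=> hu; apply: leq_trans (size_poly_exp_leq _ _) _.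
  by rewrite ltnS leq_mul2r; lia.
have szM (u w : {poly R}) c d : (size u <= c.+1)%N -> (size w <= d.+1)%N ->
    (size (u * w)%R <= (c + d).+1)%N.
  by move=> hu hw; apply: leq_trans (size_polyMleq _ _) _; lia.
move=> hf hg hh; rewrite !mulnDr; apply: (szM); last exact: szX.
by apply: (szM); exact: szX.
Qed.

(** Dimension count: there are N^3 monomials in the three elements with exponents below N, but at
    most M^2 coefficients, where M grows linearly in N. *)
Lemma plane_algebraic_relation (K : fieldType) (f0 f1 f2 : {poly {poly K}}) :
  exists N (v : nat -> nat -> nat -> K),
    [/\ exists i j k, v i j k != 0,
    forall i j k, v i j k != 0 -> [/\ (i < N)%N, (j < N)%N & (k < N)%N] &
    \sum_(i < N) (\sum_(j < N) (\sum_(k < N) (v i j k)%:P%:P * f2 ^+ k) * f1 ^+ j) * f0 ^+ i = 0].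
Proof.
have bound (u v w : nat) : exists D, [/\ (u <= D.+1)%N, (v <= D.+1)%N & (w <= D.+1)%N].
  by exists (u + v + w)%N; split; lia.
have [D1 [h0 h1 h2]] := bound (size f0) (size f1) (size f2).
(* [swapXY] turns the degree in the inner variable into a size. *)
have [D2 [h3 h4 h5]] := bound (size (swapXY f0)) (size (swapXY f1)) (size (swapXY f2)).
pose D := maxn D1 D2.
have le1 u : (u <= D1.+1)%N -> (u <= D.+1)%N by rewrite /D; lia.
have le2 u : (u <= D2.+1)%N -> (u <= D.+1)%N by rewrite /D; lia.
move: (D) le1 le2 => {}D le1 le2.
have e3 u : (3 * u = u + u + u)%N by lia.
(* Then M <= N (3D + 1) gives M^2 <= N^2 (3D + 1)^2 < N^3. *)
have [N ltN] : exists N, ((3 * D).+1 ^ 2 < N)%N by eexists.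
have [M eM] : exists M, M = (3 * D * N).+1 by eexists.
pose mon3 (t : 'I_N * 'I_N * 'I_N) := f0 ^+ t.1.1 * f1 ^+ t.1.2 * f2 ^+ t.2.
have szmon t : (size (mon3 t) <= M)%N /\ (size (swapXY (mon3 t)) <= M)%N.
  have le3 : (D * (t.1.1 + t.1.2 + t.2) <= 3 * D * N)%N.
    have -> : (3 * D * N = D * (N + N + N))%N by rewrite -mulnA e3 !mulnDr.
    rewrite leq_mul2l; apply/orP; right.
    by apply: leq_add; [apply: leq_add|]; apply: ltnW.
  rewrite eM; split.
    apply: leq_trans (size_monomial3 (D := D) _ _ _ (le1 _ h0) (le1 _ h1) (le1 _ h2)) _.
    by rewrite ltnS.
  rewrite !(rmorphM, rmorphXn) /=.
  apply: leq_trans (size_monomial3 (D := D) _ _ _ (le2 _ h3) (le2 _ h4) (le2 _ h5)) _.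
  by rewrite ltnS.
have [|v [[[[i j] k] vt] hv]] := @left_kernel_nontrivial K _ _
  (fun t (u : 'I_M * 'I_M) => (mon3 t)`_u.1`_u.2).
  rewrite !card_prod !card_ord.
  have MN : (M <= N * (3 * D).+1)%N by rewrite eM; lia.
  apply: (@leq_ltn_trans (N * (3 * D).+1 * (N * (3 * D).+1))); first exact: leq_mul.
  have -> : (N * (3 * D).+1 * (N * (3 * D).+1) = N * N * (3 * D).+1 ^ 2)%N.
    by rewrite -mulnn; lia.
  by rewrite ltn_mul2l ltN muln_gt0; lia.
(* The coefficients are extended by zero to all natural exponents. *)
pose w (i j k : nat) := if insub i is Some i' then if insub j is Some j' then
  if insub k is Some k' then v (i', j', k') else 0 else 0 else 0.
have wE (i' j' k' : 'I_N) : w i' j' k' = v (i', j', k') by rewrite /w !valK.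
exists N, w; split.
- by exists i, j, k; rewrite wE.
- move=> i' j' k'; rewrite /w.
  case: insubP => [? ? _|_]; last by rewrite eqxx.
  case: insubP => [? ? _|_]; last by rewrite eqxx.
  by case: insubP => [? ? _|_]; last by rewrite eqxx.
transitivity (\sum_t (v t)%:P%:P * mon3 t).
  transitivity (\sum_(i < N) \sum_(j < N) \sum_(k < N) (v (i, j, k))%:P%:P * mon3 (i, j, k)).
    apply: eq_bigr => i' _; rewrite mulr_suml; apply: eq_bigr => j' _.
    rewrite !mulr_suml; apply: eq_bigr => k' _.
    by rewrite wE /mon3 /=; ring.
  rewrite pair_bigA /= pair_bigA /=.
  by apply: eq_bigr => -[[i' j'] k'].
apply/polyP => c; apply/polyP => d; rewrite coef0 coef0 !coef_sum.
under eq_bigr => t _ do rewrite !coefCM.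
case: (ltnP c M) => [cM|Mc]; last first.
  by apply: big1 => t _; rewrite (nth_default 0 (leq_trans (szmon t).1 Mc)) coef0 mulr0.
case: (ltnP d M) => [dM|Md]; last first.
  apply: big1 => t _; rewrite -coef_swapXY.
  by rewrite (nth_default 0 (leq_trans (szmon t).2 Md)) coef0 mulr0.
exact: (hv (Ordinal cM, Ordinal dM)).
Qed.

Section Chains.
Variable A : comNzRingType.

(** Since [f] is outside the prime [P], the common factor f^i0 cancels modulo [P]; then [f] vanishes
    modulo [Q] and only the lowest coefficient survives. *)
Lemma peel_power (P Q : A -> Prop) (f : A) : is_prime P -> is_ideal Q ->
  (forall u, P u -> Q u) -> Q f -> ~ P f ->
  forall N i0 (g : nat -> A), (i0 < N)%N -> (forall i, (i < i0)%N -> g i = 0) ->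
  P (\sum_(i < N) g i * f ^+ i) -> Q (g i0).
Proof.
move=> hP hQ PQ Qf Pf N i0; elim: i0 N => [|i0 IH] [|N] // g iN g0.
  rewrite big_ord_recl expr0 mulr1 => /PQ h.
  set S := \sum_(_ < _) _ in h; have QS : Q S.
    apply: (ideal_sum hQ) => i _; rewrite /= /bump add1n exprS mulrCA.
    exact: (idealMl _ hQ).
  by rewrite -[g 0%N](addrK S); apply: (idealB hQ).
rewrite big_ord_recl g0 // mul0r add0r => h.
apply: (IH N (fun i => g i.+1)) => //; first by move=> i ii; apply: g0.
have [_ _ dv] := hP.
have : P (f * \sum_(i < N) g i.+1 * f ^+ i).
  rewrite mulr_sumr; move: h; congr (P _); apply: eq_bigr => i _.
  by rewrite /= /bump add1n exprS mulrCA.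
by case/dv.
Qed.

End Chains.

(* The lexicographically least exponent of an algebraic relation between
   elements of the successive differences of the chain is peeled off one variable
   at a time, which leaves a nonzero constant in the top prime. *)
Lemma plane_dim_le2 (K : fieldType) e (p : nat -> {poly {poly K}} -> Prop) :
  (forall i, is_prime (p i)) ->
  (forall i, (i < e)%N -> (forall f, p i f -> p i.+1 f) /\ exists2 f, p i.+1 f & ~ p i f) ->
  (e <= 2)%N.
Proof.
move=> hp chain; case: leqP => // e2; exfalso.
have [s0 [f0 p1f p0f]] := chain 0%N (ltnW (ltnW e2)).
have [s1 [f1 p2f p1f']] := chain 1%N (ltnW e2).
have [s2 [f2 p3f p2f']] := chain 2%N e2.
have [N [v [ex lt_N rel]]] := plane_algebraic_relation f0 f1 f2.
have least (C : nat -> Prop) : (exists i, C i) ->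
    exists i, C i /\ forall j, (j < i)%N -> ~ C j.
  move=> exC; have exP : exists i, `[< C i >] by case: exC => i /asboolT; exists i.
  case: (ex_minnP exP) => i /asboolP Ci hmin; exists i; split=> // j ji /asboolT/hmin.
  by rewrite leqNgt ji.
have [i0 [/least[j0 [/least[k0 [v0 mink]] minj]] mini]] := least _ ex.
have {}mink k : (k < k0)%N -> v i0 j0 k = 0.
  by move=> /mink h; apply/eqP/negPn/negP.
have {}minj j k : (j < j0)%N -> v i0 j k = 0.
  by move=> /minj h; apply/eqP/negPn/negP => nz; apply: h; exists k.
have {}mini i j k : (i < i0)%N -> v i j k = 0.
  by move=> /mini h; apply/eqP/negPn/negP => nz; apply: h; exists j, k.
have [i0N j0N k0N] := lt_N _ _ _ v0.
have rel0 : p 0%N (\sum_(i < N) (\sum_(j < N) (\sum_(k < N)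
    (v i j k)%:P%:P * f2 ^+ k) * f1 ^+ j) * f0 ^+ i).
  by rewrite rel; apply: ideal0 (prime_ideal (hp _)).
have := peel_power (hp 0%N) (prime_ideal (hp 1%N)) s0 p1f p0f i0N
  (g := fun i => \sum_(j < N) (\sum_(k < N) (v i j k)%:P%:P * f2 ^+ k) * f1 ^+ j) _ rel0.
move=> /(_ _)/(peel_power (hp 1%N) (prime_ideal (hp 2%N)) s1 p2f p1f' j0N
  (g := fun j => \sum_(k < N) (v i0 j k)%:P%:P * f2 ^+ k)).
move=> /(_ _ _)/(peel_power (hp 2%N) (prime_ideal (hp 3%N)) s2 p3f p2f' k0N
  (g := fun k => (v i0 j0 k)%:P%:P)) h.
have [[_ _] p1 _] := hp 3%N; apply: p1.
have -> : 1 = ((v i0 j0 k0)^-1)%:P%:P * (v i0 j0 k0)%:P%:P :> {poly {poly K}}.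
  by rewrite -!polyCM mulVf.
apply: (idealM _ (prime_ideal (hp 3%N))); apply: h => [k kk|j jj|i ii].
- by rewrite mink // !polyC0.
- by apply: big1 => k _; rewrite minj // !polyC0 mul0r.
- by apply: big1 => j _; rewrite big1 ?mul0r // => k _; rewrite mini // !polyC0 mul0r.
Qed.

(** * Noetherianity *)

(** Dickson's lemma. Exponents are compared only on the coordinates in [l], which allows induction
    on [l]. *)
Lemma dickson (n : nat) (l : seq 'I_n) (S : 'X_{1..n} -> Prop) :
  exists s : seq 'X_{1..n}, (forall m, m \in s -> S m) /\
    forall m, S m -> exists2 m', m' \in s & forall i, i \in l -> (m' i <= m i)%N.
Proof.
elim: l S => [|i l IH] S.
  case: (pselect (exists m, S m)) => [[m Sm]|no]; last first.
    by exists [::]; split=> // m Sm; case: no; exists m.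
  exists [:: m]; split=> [m'|m' _]; first by rewrite mem_seq1 => /eqP ->.
  by exists m => //; rewrite mem_seq1.
have [s [sS s_le]] := IH S.
(* Beyond this bound the coordinate [i] no longer obstructs domination by an element of [s]. *)
pose B := (\max_(m <- s) m i)%N.
have {}s_le m : S m -> (B <= m i)%N ->
    exists2 m', m' \in s & forall j, j \in i :: l -> (m' j <= m j)%N.
  move=> /s_le[m' m's le] Bm; exists m' => // j; rewrite in_cons => /orP[/eqP ->|/le //].
  apply: leq_trans Bm; rewrite /B.
  exact: (@leq_bigmax_seq _ s xpredT (fun m : 'X_{1..n} => m i) m').
(* The remaining elements are treated according to their i-th coordinate. *)
have /choice [t t_ok] c := IH (fun m => S m /\ m i = c).
exists (s ++ flatten [seq t c | c <- iota 0 B]); split=> [m|m Sm].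
  rewrite mem_cat => /orP[/sS //|/flatten_mapP[c _]].
  by move/(t_ok c).1 => [].
case: (leqP B (m i)) => [/(s_le m Sm)[m' m's le]|mB].
  by exists m' => //; rewrite mem_cat m's.
have [m' m't le] := (t_ok (m i)).2 m (conj Sm erefl).
exists m'; first by rewrite mem_cat; apply/orP; right; apply/flatten_mapP;
  exists (m i); rewrite // mem_iota.
move=> j; rewrite in_cons => /orP[/eqP ->|/le //].
by have [_ ->] := (t_ok (m i)).1 _ m't.
Qed.

(* A set of elements of I whose leading monomials generate all the leading
   monomials of I generates I, by well-founded division. *)
Lemma mpoly_noetherian (K : fieldType) (n : nat) (I : {mpoly K[n]} -> Prop) :
  is_ideal I -> exists s : seq {mpoly K[n]}, (forall f, f \in s -> I f) /\
    forall f, I f -> f \in ideal_gen (mem s : {pred {mpoly K[n]}}).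
Proof.
move=> hI.
have [s [sI s_le]] := dickson (enum 'I_n)
  (fun m => exists f : {mpoly K[n]}, [/\ I f, f != 0 & mlead f = m]).
have /choice [F hF] m : exists f : {mpoly K[n]},
    m \in s -> [/\ I f, f != 0 & mlead f = m].
  case: (boolP (m \in s)) => [/sI[f hf]|_]; by [exists f | exists 0].
exists (map F s); split; first by move=> f /mapP[m /hF[? _ _] ->].
set J := ideal_gen _; have hJ : is_ideal (fun f => f \in J) := ideal_gen_is_ideal _.
suff main m f : I f -> mlead f = m -> f \in J by move=> f If; apply: (main (mlead f)).
elim: (ltom_wf m) f => {}m _ IH f If em.
have [->|f0] := eqVneq f 0; first exact: ideal0 hJ.
have [m' m's le] := s_le m (ex_intro _ f (And3 If f0 em)).
have {}le : (m' <= m)%MM by apply/mnm_lepP => i; apply: le; rewrite mem_enum.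
have [Ig g0 eg] := hF m' m's; set g := F m' in Ig g0 eg.
have gJ : g \in J by apply: sub_ideal_gen; apply/mapP; exists m'.
pose c := f@_m / g@_m'; pose h := c *: (g * 'X_[m - m']).
have hgJ u : u \in J -> c *: (u * 'X_[m - m']) \in J.
  by move=> uJ; rewrite -mul_mpolyC; apply: (idealM _ hJ); apply: (idealMl _ hJ).
have gm0 : g@_m' != 0 by rewrite -eg mleadc_eq0.
have hm : h@_m = f@_m.
  rewrite mcoeffZ.
  have -> : (g * 'X_[m - m'])@_m = g@_m' by rewrite -[X in _@_X](submK le) mcoeffMX.
  by rewrite divfK.
have leh : (mlead h <= m)%O.
  apply: le_trans (mleadZ_le _ _) _.
  apply: le_trans (mleadM_le _ _) _.
  by rewrite mleadXm eg addmC submK.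
rewrite -[f](subrK h); apply: (idealD hJ); last exact: hgJ.
have [->|fh0] := eqVneq (f - h) 0; first exact: ideal0 hJ.
apply: IH (erefl _); last first.
  by apply: (idealB hI) => //; rewrite /h -mul_mpolyC; apply: (idealM _ hI); apply: (idealMl _ hI).
rewrite lt_neqAle; apply/andP; split.
  apply/eqP => e; have := fh0; rewrite -mleadc_eq0 e mcoeffB hm subrr eqxx //.
apply: le_trans (mleadB_le _ _) _.
by rewrite leUx em leh lexx.
Qed.

Lemma quotient_noetherian (K : fieldType) (n : nat) (J : idealr {mpoly K[n]}) :
  noetherian {ideal_quot J}.
Proof.
move=> I /idealr_closed_is_ideal hI.
pose pr : {rmorphism {mpoly K[n]} -> {ideal_quot J}} := \pi_({ideal_quot J})%qT.
have [|s [sI Is]] := @mpoly_noetherian K n (fun f => pr f \in I).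
  split; first by rewrite rmorph0; apply: ideal0 hI.
  by move=> c u v Iu Iv; rewrite rmorphD rmorphM; apply hI.
exists (map pr s) => z; apply/idP/idP.
  move=> Iz; have : repr z \in ideal_gen (mem s : {pred _}).
    by apply: Is; rewrite /pr /= reprK.
  case/ideal_genP=> c [hc e]; apply/ideal_genP.
  exists [seq (pr u.1, pr u.2) | u <- c]; split.
    by move=> _ /mapP[u /hc h ->]; apply: map_f.
  rewrite big_map -[LHS]reprK e.
  transitivity (pr (\sum_(u <- c) u.1 * u.2)); first by [].
  by rewrite rmorph_sum; apply: eq_bigr => u _; rewrite rmorphM.
by apply: (ideal_gen_min hI) => _ /mapP[f /sI h ->].
Qed.

(** * Sufficiency *)

(** If the ideal generated by [P] and a representative of [z] were proper, maximality would put that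
    representative in [P]. *)
Lemma maximal_quot_inv (A : comNzRingType) (P : prime_idealr A) :
  maximal_ideal P -> forall z : {ideal_quot P}, z <> 0 -> exists t, t * z = 1.
Proof.
case=> _ maxP z z0; pose pr : {rmorphism A -> {ideal_quot P}} := \pi_({ideal_quot P})%qT.
have pr_eq0 f : pr f = 0 <-> f \in (P : {pred A}).
  by rewrite -(rmorph0 pr) -[f in X in _ <-> X]subr0 Quotient.idealrBE; split=> /eqP.
have hP := idealr_is_ideal P.
pose I f := exists c, f - c * repr z \in (P : {pred A}).
have hI : is_ideal I.
  split; first by exists 0; rewrite mul0r subr0; apply: ideal0 hP.
  move=> c f g [d Pf] [e Pg]; exists (c * d + e).
  have -> : c * f + g - (c * d + e) * repr z = c * (f - d * repr z) + (g - e * repr z) by ring.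
  exact: hP.2.
have ez : pr (repr z) = z by rewrite /pr /= reprK.
case: (pselect (I 1)) => [[t Pt]|I1].
  exists (pr t); have /pr_eq0 := Pt; rewrite rmorphB rmorph1 rmorphM ez.
  by move/subr0_eq.
case: z0; rewrite -ez; apply/pr_eq0.
apply: (maxP _ (is_ideal_closed hI I1)) => [f Pf|]; apply/asboolT.
  by exists 0; rewrite mul0r subr0.
by exists 1; rewrite mul1r subrr; apply: ideal0 hP.
Qed.

Section PathCM.
Variables (K : fieldType) (n : nat) (a b x y : 'I_n) (p q r k : nat).
Hypothesis abxy_uniq : uniq [:: a; b; x; y].
Hypothesis abxy_all : forall i, i \in [:: a; b; x; y].

Local Notation R := {mpoly K[n]}.
Local Notation Uk := (@path_pow n a b x y p q r k).

(** A prime containing the [k]-th power contains a power of each edge product, so its variables form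
    a vertex cover. Each vertex cover has an end of ax and an end of by. *)
Lemma prime_path_cover (Q : R -> Prop) : is_prime Q ->
  (forall f, mon Uk f -> Q f) -> exists u v, [/\ (u == a) || (u == x),
    (v == b) || (v == y), Q 'X_u & Q 'X_v].
Proof.
move=> hQ UQ; have [_ _ dv] := hQ.
have edge u v d : Uk (pairmn u v d d) -> Q 'X_u \/ Q 'X_v.
  move=> /(monX K)/UQ; rewrite /pairmn mpolyXD -!mpolyXn -exprMn => /primeX h.
  exact/dv/h.
have : Q 'X_a \/ Q 'X_b.
  apply: (edge a b (p * k)%N); exists k, 0%N, 0%N.
  by rewrite !pairmnE !eqxx; split; lia.
have : Q 'X_a \/ Q 'X_x.
  apply: (edge a x (q * k)%N); exists 0%N, k, 0%N.
  by rewrite !pairmnE !eqxx; split; lia.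
have : Q 'X_b \/ Q 'X_y.
  apply: (edge b y (r * k)%N); exists 0%N, 0%N, k.
  by rewrite !pairmnE !eqxx; split; lia.
case=> [Qb|Qy].
  by case=> [Qa|Qx] _; [exists a, b | exists x, b]; rewrite !eqxx ?orbT.
case=> [Qa|Qx]; first by exists a, y; rewrite !eqxx ?orbT.
by case=> [Qa|Qb]; [exists a, y | exists x, b]; rewrite !eqxx ?orbT.
Qed.

Lemma off_plane_sub (u v : 'I_n) (Q : R -> Prop) : is_prime Q -> Q 'X_u -> Q 'X_v ->
  forall f, mon (off_plane u v) f -> Q f.
Proof.
move=> hQ Qu Qv; have hI := prime_ideal hQ; move=> f; apply: (mon_min hI) => m.
by case=> h; [have /submK <- : (U_(u) <= m)%MM by rewrite lep1mP -lt0n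
             |have /submK <- : (U_(v) <= m)%MM by rewrite lep1mP -lt0n];
  rewrite mpolyXD; apply: (idealM _ hI).
Qed.

(** All primes of the chain contain the two variables found in the lowest one, so the chain descends
    to a plane. *)
Lemma path_chain_le2 e (Q : nat -> R -> Prop) : (forall i, is_prime (Q i)) ->
  (forall f, mon Uk f -> Q 0%N f) ->
  (forall i, (i < e)%N -> (forall f, Q i f -> Q i.+1 f) /\ exists2 f, Q i.+1 f & ~ Q i f) ->
  (e <= 2)%N.
Proof.
move=> hQ UQ chain.
have [u [v [hu hv Qu Qv]]] := prime_path_cover (hQ 0%N) UQ.
have [u' [v' [uniq_uv all_uv _ _]]] := path_cover K abxy_uniq abxy_all hu hv.
have Q0 i : (i <= e)%N -> forall f, Q 0%N f -> Q i f.
  elim: i => // i IH ie f /(IH (ltnW ie)); exact: (chain i ie).1.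
have modQ i f : (i <= e)%N -> Q i f <-> Q i (of_plane K u' v' (to_plane K u' v' f)).
  move=> ie; have hI := prime_ideal (hQ i).
  have Qd : Q i (f - of_plane K u' v' (to_plane K u' v' f)).
    by apply: (Q0 i ie); apply: (off_plane_sub (hQ 0%N) Qu Qv); apply: of_plane_mod.
  split=> h.
    by rewrite -[of_plane _ _ _ _](subKr f); apply: (idealB hI).
  by rewrite -[f](subrK (of_plane K u' v' (to_plane K u' v' f))); apply: (idealD hI).
apply: (@plane_dim_le2 K e (fun i h => Q i (of_plane K u' v' h))).
  move=> i; have [hI Q1 dv] := hQ i; split; first split.
  - by rewrite rmorph0; apply: ideal0 hI.
  - by move=> c g h Qg Qh; rewrite rmorphD rmorphM; apply hI.
  - by rewrite rmorph1.
  - by move=> g h; rewrite rmorphM; apply: dv.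
move=> i ie; have [sub [f Qf nQf]] := chain i ie; split; first by move=> h /sub.
exists (to_plane K u' v' f); first exact/(modQ i.+1 f ie).
by move=> /(modQ i f (ltnW ie)).
Qed.

Hypotheses (p_gt0 : (0 < p)%N) (k_gt0 : (0 < k)%N).
Hypotheses (pq : (2 * p <= q)%N) (pr : (2 * p <= r)%N).

Lemma path_pow_proper : ~ mon Uk (1 : R).
Proof.
rewrite -mpolyX0 => /monX[i [j [l [e]]]]; rewrite !mnm0E; nia.
Qed.

Lemma path_cm (I : {pred R}) : (forall f, f \in I <-> mon Uk f) ->
  cohen_macaulay_ideal I.
Proof.
move=> IU; have hU := mon_ideal K (@path_pow_upset n a b x y p q r k).
have [J JU] := proper_ideal_idealr hU path_pow_proper.
exists J; split; first by move=> f; apply/idP/idP => [/JU/IU|/IU/JU].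
split; first exact: quotient_noetherian.
move=> P maxP; have [tau loc] := localization_localizes P.
pose pi_J : {rmorphism R -> {ideal_quot J}} := \pi_({ideal_quot J})%qT.
have hP := pi_prime P.
have JP f : f \in (J : {pred R}) -> pi_J f \in (P : {pred {ideal_quot J}}) by exact: pi_sub.
have hJ := idealr_is_ideal J.
pose Q f := pi_J f \in (P : {pred {ideal_quot J}}).
have UQ f : mon Uk f -> Q f by move=> /JU/JP.
have [u [v [hu hv Qu Qv]]] := prime_path_cover hP UQ.
have [u' [v' [uniq_uv all_uv eu ev]]] := path_cover K abxy_uniq abxy_all hu hv.
have Qoff := off_plane_sub hP Qu Qv.
pose sg := of_plane K u' v'; pose phi := to_plane K u' v'.
have sgK : cancel sg phi := of_planeK uniq_uv.
have hI := prime_ideal hP.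
have Qphi f h : phi f = h -> Q (sg h) -> Q f.
  move=> <- Qh; rewrite -[f](subrK (sg (phi f))); apply: (idealD hI) => //.
  exact/Qoff/of_plane_mod.
pose pi_P : {rmorphism _ -> {ideal_quot P}} := \pi_({ideal_quot P})%qT.
have pi_P0 z : pi_P z = 0 -> z \in (P : {pred _}).
  by rewrite -(rmorph0 pi_P) => /eqP; rewrite -Quotient.idealrBE subr0.
(* The residue field of [P] is a quotient of the coordinate ring of the plane, so a nonzero
   polynomial in each coordinate vanishes in it. *)
have [|[G1 G10 e1] [G2 G20 e2]] := @zariski_plane K {ideal_quot P}
    (maximal_quot_inv maxP) (pi_P \o pi_J \o sg).
  move=> z; exists (phi (repr (repr z))).
  have : Q (repr (repr z) - sg (phi (repr (repr z)))) by apply/Qoff/of_plane_mod.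
  move=> h; have /eqP : pi_P (pi_J (repr (repr z) - sg (phi (repr (repr z))))) == 0.
    by rewrite -(rmorph0 pi_P) -Quotient.idealrBE subr0.
  rewrite !rmorphB => /subr0_eq /esym; rewrite /pi_J /= reprK /pi_P /= reprK.
  exact.
pose F := (map_poly (@mpolyC n K) G1).['X_a + 'X_x].
pose G := (map_poly (@mpolyC n K) G2).['X_b + 'X_y].
have QF : Q F.
  apply: (Qphi _ G1%:P); first by rewrite /F eu; apply: (to_plane_polyX uniq_uv).
  by apply: pi_P0.
have QG : Q G.
  apply: (Qphi _ (map_poly polyC G2)); first by rewrite /G ev; apply: (to_plane_polyY uniq_uv).
  by apply: pi_P0.
have [regF regG] : weakly_regular Uk F G by apply: path_pow_regular.
have [||reg sub] := loc_regular2 hP JP loc QF QG.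
- by move=> z /JU/regF/JU.
- by move=> z w /JU/regG[w' /JU h]; exists w'.
apply: (local_cm (loc_local hP JP loc) sub reg) => e.
case/(loc_chain_pull hP loc) => C [hC JC chain].
by apply: path_chain_le2 hC _ chain => f /JU; apply: JC.
Qed.

End PathCM.

(** * Depth at the origin *)

Section Origin.
Variables (K : fieldType) (n : nat).
Implicit Types (U : 'X_{1..n} -> Prop) (f g : {mpoly K[n]}) (F : pred 'I_n).

Definition at_origin f : Prop := f@_0%MM = 0.

Lemma origin_prime : is_prime at_origin.
Proof.
split; first split.
- exact: mcoeff0.
- by move=> c u v hu hv; rewrite /at_origin mcoeffD rmorphM /= hu hv mulr0 addr0.
- by apply/eqP; rewrite mcoeff1 eqxx oner_eq0.
- move=> u v; rewrite /at_origin rmorphM => /eqP.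
  by rewrite mulf_eq0 => /orP[]/eqP; [left | right].
Qed.

Lemma mon_origin U f : ~ U 0%MM -> mon U f -> at_origin f.
Proof. by move=> U0 hf; apply: mon_coef0 hf U0. Qed.

Lemma origin_min (I : {mpoly K[n]} -> Prop) : is_ideal I ->
  (forall i, I 'X_i) -> forall f, at_origin f -> I f.
Proof.
move=> hI IX f f0; apply: (@mon_min K n (fun m => m != 0%MM) I f hI).
  move=> m m0; have [i mi] : exists i, m i != 0%N.
    apply: contrapT => no; case/eqP: m0; apply/mnmP => i; rewrite mnm0E.
    by apply/eqP; apply: contrapT => /negP mi; apply: no; exists i.
  have /submK <- : (U_(i) <= m)%MM by rewrite lep1mP.
  by rewrite mpolyXD; apply: (idealM _ hI).
move=> m; rewrite mcoeff_msupp; apply: contraNneq => ->; exact/eqP.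
Qed.

(** Localizing at the origin does not enlarge a monomial ideal. At an exponent outside [U], smaller
    exponents of [f] contribute nothing by induction, so only the nonzero constant term of [s]
    acts. *)
Lemma mon_cancel U s f : upset U -> ~ at_origin s -> mon U (s * f) -> mon U f.
Proof.
move=> upU s0 hsf; apply/monE => m; apply: contra_neqP.
elim: (ltom_wf m) => {}m _ IH Um.
have split_s : s * f = s@_0 *: f + (s - (s@_0)%:MP) * f.
  by rewrite -mul_mpolyC; ring.
have := mon_coef0 hsf Um; rewrite split_s mcoeffD mcoeffZ mcoeffM.
rewrite [X in _ + X]big1 ?addr0 => [/eqP|[m1 m2] /= /eqP em].
  by rewrite mulf_eq0 => /orP[/eqP/s0//|/eqP].
have [e1|n1] := eqVneq (m1 : 'X_{1..n}) 0%MM.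
  by rewrite e1 mcoeffB mcoeffC eqxx mulr1 subrr mul0r.
have lt12 : ((m2 : 'X_{1..n}) < (m1 + m2)%MM)%O.
  rewrite lt_neqAle lemc_addl andbT; apply: contra_neq n1 => e.
  by apply: (@addIm _ m2); rewrite add0m.
have U12 : U m2 -> U (m1 + m2)%MM by rewrite addmC; apply: upU.
rewrite -em in lt12 U12; rewrite (IH _ lt12) ?mulr0 //.
by move=> /U12.
Qed.

Definition face_vars F i : {mpoly K[n]} := if F i then 'X_i else 0.
Lemma face_exists F : {rho : {rmorphism {mpoly K[n]} -> {mpoly K[n]}} |
  (forall i, rho 'X_i = face_vars F i) /\ forall c, rho c%:MP = c%:MP}.
Proof.
exists (mmap (@mpolyC n K) (face_vars F)).
by split=> [i|c]; rewrite /= ?mmapC ?mmapX ?mmap1U.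
Qed.

(* Opaque, so that unification does not unfold the evaluation. *)
Definition face F := sval (face_exists F).

Lemma faceX F i : face F 'X_i = face_vars F i.
Proof. exact: (svalP (face_exists F)).1. Qed.

Lemma faceC F c : face F c%:MP = c%:MP.
Proof. exact: (svalP (face_exists F)).2. Qed.

Lemma face_mod (I : {mpoly K[n]} -> Prop) F f : is_ideal I ->
  (forall i, ~~ F i -> I 'X_i) -> I (f - face F f).
Proof.
move=> hI IX; apply: (mpoly_congr (rho := face F) hI) => [c|i]; first exact: faceC.
rewrite faceX /face_vars; case: (boolP (F i)) => [_|/IX]; last by rewrite subr0.
by rewrite subrr; apply: ideal0 hI.
Qed.

Lemma face_prime F : is_prime (fun f => face F f = 0).
Proof.
split; first split.
- exact: rmorph0.
- by move=> c u v hu hv; rewrite rmorphD rmorphM hu hv mulr0 addr0.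
- by rewrite rmorph1; apply/eqP; rewrite oner_eq0.
- move=> u v; rewrite rmorphM => /eqP.
  by rewrite mulf_eq0 => /orP[]/eqP; [left | right].
Qed.

Lemma face_eq0_sub F (I : {mpoly K[n]} -> Prop) f : is_ideal I ->
  (forall i, ~~ F i -> I 'X_i) -> face F f = 0 -> I f.
Proof. by move=> hI IX f0; have := @face_mod I F f hI IX; rewrite f0 subr0. Qed.

Lemma mon_face U F f : (forall m, U m -> exists2 i, ~~ F i & (0 < m i)%N) ->
  mon U f -> face F f = 0.
Proof.
move=> hU; apply: (mon_min (prime_ideal (face_prime F))) => m /hU[i /negbTE Fi mi].
have /submK <- : (U_(i) <= m)%MM by rewrite lep1mP -lt0n.
by rewrite mpolyXD rmorphM faceX /face_vars Fi mulr0.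
Qed.

(* The map f |-> X^w f|_F on the maximal ideal is linear modulo the monomial
   ideal but is not a multiplication, whereas depth at least 2 would force it
   to be one. *)
Lemma depth_obstruction U w F i0 j0 f1 f2 : upset U ->
  (forall i j, ~~ F i -> F j -> U (w + U_(i) + U_(j))%MM) ->
  ~~ F i0 -> F j0 -> ~ U (w + U_(i0))%MM -> ~ U (w + U_(j0))%MM ->
  at_origin f1 -> at_origin f2 ->
  (forall z, mon U (f1 * z) -> exists2 s, ~ at_origin s & mon U (s * z)) ->
  (forall z v, mon U (f2 * z - f1 * v) ->
     exists s v', ~ at_origin s /\ mon U (s * z - f1 * v')) -> False.
Proof.
move=> upU hU Fi0 Fj0 Ui0 Uj0 of1 of2 reg1 reg2; have hI := mon_ideal K upU.
pose phi f := 'X_[w] * face F f.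
(* For [f] and [g] both in m, the reduced form is symmetric, so [g * phi f] and [f * phi g] agree
   modulo the ideal. *)
have phi_lin g f : at_origin f -> mon U (g * phi f - 'X_[w] * face F g * face F f).
  move=> f0; pose I1 h := mon U ('X_[w] * h * face F f).
  have hI1 : is_ideal I1.
    split; first by rewrite /I1 mulr0 mul0r; apply: ideal0 hI.
    move=> c u v hu hv; rewrite /I1.
    have -> : 'X_[w] * (c * u + v) * face F f =
      c * ('X_[w] * u * face F f) + 'X_[w] * v * face F f by ring.
    exact: hI.2.
  suff : I1 (g - face F g) by rewrite /I1 /phi; congr (mon U _); ring.
  apply: face_mod => // i Fi.
  pose I2 h := mon U ('X_[w] * 'X_i * face F h).
  suff : I2 f by [].
  apply: (@origin_min I2 _ _ f f0) => [|j].
    split; first by rewrite /I2 rmorph0 mulr0; apply: ideal0 hI.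
    move=> c u v hu hv; rewrite /I2 rmorphD rmorphM.
    have -> : 'X_[w] * 'X_i * (face F c * face F u + face F v) =
      face F c * ('X_[w] * 'X_i * face F u) + 'X_[w] * 'X_i * face F v by ring.
    exact: hI.2.
  rewrite /I2 faceX /face_vars; case: ifP => Fj; last by rewrite mulr0; apply: ideal0 hI.
  by rewrite -!mpolyXD; apply/monX/hU.
(* By this symmetry [f2 * phi f1] is a multiple of [f1]; regularity of [f2] modulo [f1] then divides
   [phi f1] by [f1], up to [s]. *)
have [s [c [s0 hs]]] : exists s c, ~ at_origin s /\ mon U (s * phi f1 - f1 * c).
  apply: (reg2 _ (phi f2)).
  have -> : f2 * phi f1 - f1 * phi f2 = (f2 * phi f1 - 'X_[w] * face F f2 * face F f1)
    - (f1 * phi f2 - 'X_[w] * face F f1 * face F f2) by ring.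
  by apply: (idealB hI); apply: phi_lin.
(* Multiplied by [f1], the claim follows from symmetry, and [f1] cancels. Thus [s * phi] is
   multiplication by [c] on all of m. *)
have mult f : at_origin f -> mon U (s * phi f - f * c).
  move=> f0; suff : mon U (f1 * (s * phi f - f * c)).
    by case/reg1=> t t0; apply: mon_cancel.
  have -> : f1 * (s * phi f - f * c) =
    s * ((f1 * phi f - 'X_[w] * face F f1 * face F f)
      - (f * phi f1 - 'X_[w] * face F f * face F f1)) + f * (s * phi f1 - f1 * c) by ring.
  by apply: (idealD hI); apply: (idealM _ hI) => //; apply: (idealB hI); apply: phi_lin.
have originX i : at_origin 'X_i by rewrite /at_origin mcoeffX mnm1_eq0.
(* [phi] kills the variable [i0], so [c] has no term X^w. At the variable [j0] the same coefficient
   must equal the constant term of [s], which is nonzero. *)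
have c_w : c@_w = 0.
  have := mon_coef0 (mult _ (originX i0)) Ui0.
  rewrite /phi faceX /face_vars (negbTE Fi0) !mulr0 sub0r mcoeffN ['X_i0 * c]mulrC.
  rewrite [(w + _)%MM]addmC mcoeffMX.
  by move/eqP; rewrite oppr_eq0 => /eqP.
apply: s0; have := mon_coef0 (mult _ (originX j0)) Uj0.
rewrite /phi faceX /face_vars Fj0 -mpolyXD ['X_j0 * c]mulrC mcoeffB.
have -> : (s * 'X_[w + U_(j0)])@_(w + U_(j0)) = s@_0%MM.
  by rewrite -[X in _@_X]addm0 mcoeffMX.
by rewrite [(w + _)%MM]addmC mcoeffMX c_w subr0.
Qed.

(** The three nested coordinate faces give a chain of primes of length 2 at the origin.
    Cohen-Macaulayness would then supply the two elements excluded by [depth_obstruction]. *)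
Lemma origin_not_cm U w F i0 j0 (I : {pred {mpoly K[n]}}) (F0 F1 F2 : pred 'I_n) :
  (forall f, f \in I <-> mon U f) -> upset U ->
  (forall m, U m -> exists2 i, ~~ F0 i & (0 < m i)%N) ->
  {subset F2 <= F1} -> {subset F1 <= F0} ->
  (exists2 i, F0 i & ~~ F1 i) -> (exists2 i, F1 i & ~~ F2 i) ->
  (forall i j, ~~ F i -> F j -> U (w + U_(i) + U_(j))%MM) ->
  ~~ F i0 -> F j0 -> ~ U (w + U_(i0))%MM -> ~ U (w + U_(j0))%MM ->
  ~ cohen_macaulay_ideal I.
Proof.
move=> IU upU hF0 F21 F10 [i1 F0i1 F1i1] [i2 F1i2 F2i2] hw Fi0 Fj0 Ui0 Uj0.
case=> J [JI [_ cm]].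
have U0 : ~ U 0%MM by move=> /hF0[i _]; rewrite mnm0E.
have JU f : f \in (J : {pred _}) <-> mon U f by rewrite JI.
have Jorigin f : f \in (J : {pred _}) -> at_origin f by move=> /JU; apply: mon_origin.
pose pr : {rmorphism {mpoly K[n]} -> {ideal_quot J}} := \pi_({ideal_quot J})%qT.
have hM := origin_prime; have hO := prime_ideal hM.
have reprO f : at_origin (repr (pr f)) <-> at_origin f.
  have : at_origin (repr (pr f) - f).
    by apply: Jorigin; rewrite Quotient.idealrBE reprK.
  rewrite /at_origin mcoeffB => /eqP; rewrite subr_eq0 => /eqP -> //.
have prK z : pr (repr z) = z by rewrite /pr /= reprK.
have hQ : is_prime (fun z : {ideal_quot J} => at_origin (repr z)).
  split; first split.
  - by rewrite -(rmorph0 pr); apply/reprO; apply: ideal0 hO.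
  - move=> c u v hu hv; rewrite -[c]prK -[u]prK -[v]prK -rmorphM -rmorphD.
    exact/reprO/hO.2.
  - by rewrite -(rmorph1 pr) => /reprO; case: hM.
  - move=> u v; rewrite -{1}[u]prK -{1}[v]prK -rmorphM => /reprO.
    by case: hM => _ _; apply.
have [P hP] := is_prime_idealr hQ.
have maxP : maximal_ideal (P : {pred {ideal_quot J}}).
  split.
    split; [exact: idealr0 | by rewrite idealr1 |].
    by move=> c u v Pu Pv; apply: (idealr_is_ideal P).2.
  move=> I' hI' PI' z I'z; have hI'' := idealr_closed_is_ideal hI'.
  apply/hP; apply: contrapT => z0.
  (* Modulo [P] every class is its constant term, so an ideal that contains [P] and a class outside
     [P] contains a nonzero constant. *)
  have zc : z - pr ((repr z)@_0)%:MP \in I'.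
    apply: PI'; apply/hP; rewrite -{1}[z]prK -rmorphB; apply/reprO.
    by rewrite /at_origin mcoeffB mcoeffC eqxx mulr1 subrr.
  have c1 : pr ((repr z)@_0)%:MP \in I'.
    by rewrite -[X in X \in _](subKr z); apply: (idealB hI'').
  have [_ /negP I'1 _] := hI'; apply: I'1.
  rewrite -(rmorph1 pr) -mpolyC1 -(mulVf (introN eqP z0)) mpolyCM rmorphM.
  exact: (idealM _ hI'').
have [tau loc] := localization_localizes P.
have hP' := pi_prime P.
have PE f : \pi_({ideal_quot J})%qT f \in (P : {pred _}) <-> at_origin f.
  exact: iff_trans (hP _) (reprO f).
have JP f : f \in (J : {pred _}) -> \pi_({ideal_quot J})%qT f \in (P : {pred _}).
  by move/Jorigin/PE.
have face_sub (E E' : pred 'I_n) : {subset E' <= E} ->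
    forall f, face E f = 0 -> face E' f = 0.
  move=> sub f; apply: face_eq0_sub (prime_ideal (face_prime E')) _ => i nEi.
  by rewrite faceX /face_vars; case: ifP => // /sub; rewrite unfold_in (negbTE nEi).
pose C i f := face (if i is 0%N then F0 else if i is 1%N then F1 else F2) f = 0.
have chain : prime_chain (localization P) 2.
  apply: (loc_chain_push hP' loc (p := C)).
    move=> i; split; first exact: face_prime.
      move=> f /JU; apply: mon_face => m /hF0[j F0j mj]; exists j => //.
      apply: contra F0j; case: i => [|[|i]] //; first exact: F10.
      by move=> /F21/F10.
    move=> f; rewrite /C => f0; apply/PE; apply: face_eq0_sub hO _ f0 => i' _.
    by rewrite /at_origin mcoeffX mnm1_eq0.
  have strict (E E' : pred 'I_n) i : E i -> ~~ E' i ->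
      exists2 f, face E' f = 0 & ~ face E f = 0.
    move=> Ei E'i; exists 'X_i; rewrite faceX /face_vars ?(negbTE E'i) ?Ei //.
    by apply/eqP; rewrite -msize_poly_eq0 msizeX.
  case=> [|[|//]] _; split; rewrite /C.
  - exact: face_sub.
  - exact: strict F0i1 F1i1.
  - exact: face_sub.
  - exact: strict F1i2 F2i2.
have [f1 [f2 [/PE o1 /PE o2 reg1 reg2]]] := loc_cm_regular2 hP' JP loc (cm P maxP) chain.
apply: (@depth_obstruction U w F i0 j0 f1 f2) => //.
  move=> z /JU/reg1[s Ps /JU hs]; exists s => //.
  by move/PE.
move=> z v /JU/reg2[s [v' [Ps /JU hs]]]; exists s, v'; split=> //.
by move/PE.
Qed.

End Origin.

(** * Necessity *)

Lemma path_ideal_exp (K : fieldType) (G : weighted_graph 4) (a b x y : 'I_4) k :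
  uniq [:: a; b; x; y] ->
  edges G = [set [set a; b]; [set a; x]; [set b; y]] ->
  forall f, f \in ideal_exp (weighted_edge_ideal K G) k <->
  mon (path_pow a b x y (weight G [set a; b]) (weight G [set a; x])
    (weight G [set b; y]) k) f.
Proof.
move=> abxy eG; set p := weight G _; set q := weight G _; set r := weight G _.
have [ab ax ay bx [by_ xy]] := abxy_neq abxy.
have edgeX u v d : u != v ->
    (\prod_(c in [set u; v]) 'X_c) ^+ d = 'X_[pairmn u v d d] :> {mpoly K[4]}.
  move=> uv; rewrite big_setU1 ?finset.in_set1 //= finset.big_set1 exprMn !mpolyXn.
  by rewrite /pairmn mpolyXD.
have hI f : f \in weighted_edge_ideal K G <-> mon (path_pow a b x y p q r 1) f.
  split.
    apply: ideal_gen_min; first exact/mon_ideal/path_pow_upset.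
    move=> g /existsP[e /andP[]]; rewrite eG !finset.in_setU !finset.in_set1 => he /eqP ->.
    case/orP: he => [/orP[]|] /eqP ->; rewrite edgeX ?ab ?ax ?by_ //; apply/monX.
    - by exists 1%N, 0%N, 0%N; rewrite !pairmnE !eqxx !ab ?ax ?ay ?bx ?xy ?by_; split; lia.
    - by exists 0%N, 1%N, 0%N; rewrite !pairmnE !eqxx !ax ?ab ?ay ?bx ?xy ?by_; split; lia.
    - by exists 0%N, 0%N, 1%N; rewrite !pairmnE !eqxx !by_ ?ab ?ax ?ay ?bx ?xy; split; lia.
  have hG := ideal_gen_is_ideal (_ : {pred {mpoly K[4]}}).
  apply: (mon_min (hG _)) => m [i [j [l [e ha hb hx hy]]]].
  have gen u v : u != v -> [set u; v] \in edges G ->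
      (weight G [set u; v] <= m u)%N -> (weight G [set u; v] <= m v)%N ->
      'X_[m] \in weighted_edge_ideal K G.
    set d := weight G _ => uv uvG du dv.
    have /submK <- : (pairmn u v d d <= m)%MM.
      apply/mnm_lepP => c; rewrite pairmnE.
      have [<-|_] := eqVneq u c; first by rewrite eq_sym (negbTE uv); lia.
      by have [<-|_] := eqVneq v c; lia.
    rewrite mpolyXD; apply: (idealM _ (hG _)); apply: sub_ideal_gen.
    apply/existsP; exists [set u; v]; rewrite uvG edgeX //; exact: eqxx.
  have : (i = 1 \/ j = 1 \/ l = 1)%N by lia.
  rewrite -/(weighted_edge_ideal K G).
  case=> [ei|[ej|el]]; subst.
  - by apply: (gen a b); rewrite ?ab // ?eG ?finset.in_setU ?finset.in_set1 ?eqxx -/p; lia.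
  - by apply: (gen a x); rewrite ?ax // ?eG ?finset.in_setU ?finset.in_set1 ?eqxx ?orbT -/q //; lia.
  - by apply: (gen b y); rewrite ?by_ // ?eG ?finset.in_setU ?finset.in_set1 ?eqxx ?orbT -/r //; lia.
elim: k => [|k IH] f; first by split=> // _ m _; apply: path_pow0.
apply: iff_trans (mon_ideal_mul _ _ hI IH f) _; try exact: path_pow_upset.
by apply: eq_mon => m; apply: iff_sym; apply: path_pow_step.
Qed.

Section NotCM.
Variables (K : fieldType) (n : nat) (a b x y : 'I_n) (p q r : nat).
Hypothesis abxy_uniq : uniq [:: a; b; x; y].
Hypothesis abxy_all : forall i, i \in [:: a; b; x; y].
Hypotheses (p_gt0 : (0 < p)%N) (q_gt0 : (0 < q)%N) (r_gt0 : (0 < r)%N).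
Local Notation U := (path_pow a b x y p q r).

Definition mn4 sa sb sx sy : 'X_{1..n} :=
  (U_(a) *+ sa + U_(b) *+ sb + (U_(x) *+ sx + U_(y) *+ sy))%MM.

(** The chain at the origin is (a,b), (a,b,x), (a,b,x,y); for [k > 0] every monomial of the power
    involves a or b. *)
Lemma path_not_cm k w (F : pred 'I_n) i0 j0 (I : {pred {mpoly K[n]}}) :
  (0 < k)%N -> (forall f, f \in I <-> mon (U k) f) ->
  (forall i j, ~~ F i -> F j -> U k (w + U_(i) + U_(j))%MM) ->
  ~~ F i0 -> F j0 -> ~ U k (w + U_(i0))%MM -> ~ U k (w + U_(j0))%MM ->
  ~ cohen_macaulay_ideal I.
Proof.
move=> k0 IU hw Fi0 Fj0 Ui0 Uj0.
have [ab ax ay bx [by_ xy]] := abxy_neq abxy_uniq.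
apply: (@origin_not_cm K n (U k) w F i0 j0 I
  [pred i | (i == x) || (i == y)] [pred i | i == y] pred0) => //.
- exact: path_pow_upset.
- move=> m [i [j [l [e ha hb _ _]]]].
  have [ma|mb] : ((0 < m a) \/ (0 < m b))%N by nia.
    by exists a => //=; rewrite ax ay.
  by exists b => //=; rewrite bx by_.
- by move=> i; rewrite unfold_in /= => yi; rewrite unfold_in /= yi orbT.
- by exists x; rewrite /= ?eqxx ?xy.
- by exists y; rewrite /= ?eqxx.
Qed.

(** With w = a^(p-1) b^(max(p,r)-1) x^(q-1) y^(r-1), the products wab, wxb, wyb lie in (ab)^p,
    (ax)^q, (by)^r; the second uses q < p. The choice of [i0] depends on whether b^(max(p,r)-1)
    falls short for ab or for by. *)
Lemma path_not_cm_lt (I : {pred {mpoly K[n]}}) : (q < p)%N ->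
  (forall f, f \in I <-> mon (U 1) f) -> ~ cohen_macaulay_ideal I.
Proof.
move=> qp IU; have [ab ax ay bx [by_ xy]] := abxy_neq abxy_uniq.
apply: (@path_not_cm 1 (mn4 p.-1 (maxn p r).-1 q.-1 r.-1) (pred1 b)
  (if (r <= p)%N then a else y) b) => //.
- move=> i j /= nib /eqP ->; have := abxy_all i.
  rewrite !in_cons in_nil orbF (negbTE nib) => /or4P[/eqP ->|//|/eqP ->|/eqP ->];
    [exists 1%N, 0%N, 0%N | exists 0%N, 1%N, 0%N | exists 0%N, 0%N, 1%N];
    rewrite !mnmDE !mulmnE !mnm1E !eqxx ?ab ?ax ?ay ?bx ?by_ ?xy; split; lia.
- by case: ifP; rewrite /= ?ab ?by_.
- exact: eqxx.
- case: leqP => rp [i [j [l [e]]]];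
    rewrite !mnmDE !mulmnE !mnm1E !eqxx ?ab ?ax ?ay ?bx ?by_ ?xy;
    (have [[? [? ?]]|[[? [? ?]]|[? [? ?]]]] : (i = 1 /\ j = 0 /\ l = 0) \/
      (i = 0 /\ j = 1 /\ l = 0) \/ (i = 0 /\ j = 0 /\ l = 1) by lia); subst; lia.
- case=> i [j [l [e]]];
    rewrite !mnmDE !mulmnE !mnm1E !eqxx ?ab ?ax ?ay ?bx ?by_ ?xy;
    (have [[? [? ?]]|[[? [? ?]]|[? [? ?]]]] : (i = 1 /\ j = 0 /\ l = 0) \/
      (i = 0 /\ j = 1 /\ l = 0) \/ (i = 0 /\ j = 0 /\ l = 1) by lia); subst; lia.
Qed.

(** With w = a^(2p-1) b^(p+r-1) x^(q-1) y^(r-1), the products way, wby, wxy are divisible by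
    (ab)^(2p), (ab)^p (by)^r, (ax)^q (by)^r; the first uses p < r and the last q < 2p. *)
Lemma path_not_cm_mid (I : {pred {mpoly K[n]}}) :
  (p <= q)%N -> (q < 2 * p)%N -> (p < r)%N ->
  (forall f, f \in I <-> mon (U 2) f) -> ~ cohen_macaulay_ideal I.
Proof.
move=> leq_pq qp pr IU; have [ab ax ay bx [by_ xy]] := abxy_neq abxy_uniq.
apply: (@path_not_cm 2 (mn4 (2 * p).-1 (p + r).-1 q.-1 r.-1) (pred1 y) b y) => //.
- move=> i j /= niy /eqP ->; have := abxy_all i.
  rewrite !in_cons in_nil orbF (negbTE niy) orbF => /or3P[]/eqP ->;
    [exists 2%N, 0%N, 0%N | exists 1%N, 0%N, 1%N | exists 0%N, 1%N, 1%N];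
    rewrite !mnmDE !mulmnE !mnm1E !eqxx ?ab ?ax ?ay ?bx ?by_ ?xy; split; lia.
- by rewrite /= by_.
- exact: eqxx.
- case=> i [j [l [e]]]; rewrite !mnmDE !mulmnE !mnm1E !eqxx ?ab ?ax ?ay ?bx ?by_ ?xy.
  by case: i j l e => [|[|[|i]]] [|[|[|j]]] [|[|[|l]]] e //; lia.
- case=> i [j [l [e]]]; rewrite !mnmDE !mulmnE !mnm1E !eqxx ?ab ?ax ?ay ?bx ?by_ ?xy.
  by case: i j l e => [|[|[|i]]] [|[|[|j]]] [|[|[|l]]] e //; lia.
Qed.

(** With w = (ab)^(2p-1) (xy)^(p-1), each product of w with one of a, y and one of b, x is divisible
    by a product of two generators. *)
Lemma path_not_cm_eq (I : {pred {mpoly K[n]}}) : q = p -> r = p ->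
  (forall f, f \in I <-> mon (U 2) f) -> ~ cohen_macaulay_ideal I.
Proof.
move=> eq_qp eq_rp IU; have [ab ax ay bx [by_ xy]] := abxy_neq abxy_uniq.
apply: (@path_not_cm 2 (mn4 (2 * p).-1 (2 * p).-1 p.-1 p.-1)
  [pred i | (i == b) || (i == x)] a b) => //.
- rewrite eq_qp eq_rp => i j /= /norP[nib nix] hj; have := abxy_all i.
  rewrite !in_cons in_nil orbF (negbTE nib) (negbTE nix) /= => /orP[]/eqP ->;
    case/orP: hj => /eqP ->;
    [exists 2%N, 0%N, 0%N | exists 1%N, 1%N, 0%N | exists 1%N, 0%N, 1%N | exists 0%N, 1%N, 1%N];
    rewrite !mnmDE !mulmnE !mnm1E !eqxx ?ab ?ax ?ay ?bx ?by_ ?xy; split; lia.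
- by rewrite /= ab ax.
- by rewrite /= eqxx.
- rewrite eq_qp eq_rp => -[i [j [l [e]]]].
  rewrite !mnmDE !mulmnE !mnm1E !eqxx ?ab ?ax ?ay ?bx ?by_ ?xy.
  by case: i j l e => [|[|[|i]]] [|[|[|j]]] [|[|[|l]]] e //; lia.
- rewrite eq_qp eq_rp => -[i [j [l [e]]]].
  rewrite !mnmDE !mulmnE !mnm1E !eqxx ?ab ?ax ?ay ?bx ?by_ ?xy.
  by case: i j l e => [|[|[|i]]] [|[|[|j]]] [|[|[|l]]] e //; lia.
Qed.

End NotCM.

Lemma path_pow_swap n (a b x y : 'I_n) p q r k m :
  path_pow a b x y p q r k m <-> path_pow b a y x p r q k m.
Proof. by split=> -[i [j [l [? ? ? ? ?]]]]; exists i, l, j; split=> //; lia. Qed.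

(** A weight below p already spoils the first power. Otherwise the square fails: directly if r > p,
    after exchanging the two ends if r = p < q, and by the balanced monomial if all weights
    agree. *)
Lemma path_powers_not_cm (K : fieldType) n (a b x y : 'I_n) p q r
    (I : nat -> {pred {mpoly K[n]}}) :
  uniq [:: a; b; x; y] -> (forall i, i \in [:: a; b; x; y]) ->
  (0 < p)%N -> (0 < q)%N -> (0 < r)%N -> (q < 2 * p)%N ->
  (forall k f, f \in I k <-> mon (path_pow a b x y p q r k) f) ->
  ~ forall k, (1 <= k)%N -> cohen_macaulay_ideal (I k).
Proof.
move=> abxy abxy_all p0 q0 r0 q2p IU cm.
have baxy : uniq [:: b; a; y; x].
  have [ab ax ay bx [by_ xy]] := abxy_neq abxy.
  by rewrite /= !in_cons !in_nil ab ax ay bx by_ xy.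
have baxy_all i : i \in [:: b; a; y; x].
  by have := abxy_all i; rewrite !in_cons !in_nil; do 4!case: (i == _).
have IU' k f : f \in I k <-> mon (path_pow b a y x p r q k) f.
  by apply: iff_trans (IU k f) _; apply: eq_mon => m; apply: path_pow_swap.
case: (ltnP q p) => [qp|pq].
  exact: path_not_cm_lt abxy abxy_all p0 q0 r0 (I 1%N) qp (IU 1%N) (cm 1%N isT).
case: (ltnP p r) => [pr|rp].
  exact: path_not_cm_mid abxy abxy_all p0 q0 r0 (I 2%N) pq q2p pr (IU 2%N) (cm 2%N isT).
case: (ltnP r p) => [r_lt_p|pr].
  exact: path_not_cm_lt baxy baxy_all p0 r0 q0 (I 1%N) r_lt_p (IU' 1%N) (cm 1%N isT).
have er : r = p by lia.
case: (ltnP p q) => [p_lt_q|qp].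
  have r2p : (r < 2 * p)%N by lia.
  exact: path_not_cm_mid baxy baxy_all p0 r0 q0 (I 2%N) pr r2p p_lt_q (IU' 2%N) (cm 2%N isT).
have eq : q = p by lia.
exact: path_not_cm_eq abxy abxy_all p0 q0 r0 (I 2%N) eq er (IU 2%N) (cm 2%N isT).
Qed.

Theorem proposition4p3 (K : fieldType) (G : weighted_graph 4)
    (a b x y : 'I_4) :
  uniq [:: a; b; x; y] ->
  edges G = [set [set a; b]; [set a; x]; [set b; y]] ->
  ((forall n : nat, (1 <= n)%N ->
     cohen_macaulay_ideal (ideal_exp (weighted_edge_ideal K G) n))
  <->
  (2 * weight G [set a; b] <= minn (weight G [set a; x]) (weight G [set b; y]))%N).
Proof.
move=> abxy eG.
(* Four distinct elements exhaust ['I_4]. *)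
have abxy_all i : i \in [:: a; b; x; y].
  have /subset_cardP/(_ (subset_predT _)) -> // : #|[:: a; b; x; y]| = #|'I_4|.
  by rewrite card_ord; apply/card_uniqP.
have w_gt0 u v : [set u; v] \in edges G -> (0 < weight G [set u; v])%N by apply: weight_gt0.
have p0 : (0 < weight G [set a; b])%N by rewrite w_gt0 // eG !finset.in_setU !finset.in_set1 eqxx.
have q0 : (0 < weight G [set a; x])%N.
  by rewrite w_gt0 // eG !finset.in_setU !finset.in_set1 eqxx orbT.
have r0 : (0 < weight G [set b; y])%N.
  by rewrite w_gt0 // eG !finset.in_setU !finset.in_set1 eqxx orbT.
have IU k f := @path_ideal_exp K G a b x y k abxy eG f.
rewrite leq_min; split=> [cm|/andP[pq pr] k k0]; last first.
  by apply: (path_cm abxy abxy_all p0 k0 pq pr) => f; apply: IU.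
apply/andP; split; rewrite leqNgt; apply/negP => lt2.
  exact: (path_powers_not_cm abxy abxy_all p0 q0 r0 lt2 IU).
(* Failure of the inequality for by is the previous case read from the other end of the path. *)
have baxy : uniq [:: b; a; y; x].
  have [ab ax ay bx [by_ xy]] := abxy_neq abxy.
  by rewrite /= !in_cons !in_nil ab ax ay bx by_ xy.
have baxy_all i : i \in [:: b; a; y; x].
  by have := abxy_all i; rewrite !in_cons !in_nil; do 4!case: (i == _).
apply: (path_powers_not_cm baxy baxy_all p0 r0 q0 lt2 _ cm) => k f.
by apply: iff_trans (IU k f) _; apply: eq_mon => m; apply: path_pow_swap.
Qed.
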